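(* Let $E$ be a real locally convex Hausdorff topological vector space. Then $E$ has the metric convex compactness property if and only if for every continuous map $f:[0,1]\to E$ the Pettis integral $\int_0^1 f(t)\,dt$ (with respect to Lebesgue measure on $[0,1]$) exists in $E$.
   Context: A locally convex Hausdorff space $E$ has the metric convex compactness property if for every compact metrizable subset $K\subset E$ (metrizable in the relative topology) the closed convex hull of $K$ in $E$ is compact. Let $E'$ denote the space of continuous linear functionals on $E$, with pairing $\langle e',e\rangle$. For a measure $\nu$ on a space $X$ and a function $f:X\to E$, the function $f$ is $\nu$-Pettis integrable, i.e. its Pettis integral $\int_X f\,d\nu$ exists in $E$, if for every $e'\in E'$ the scalar function $x\mapsto\langle e',f(x)\rangle$ is $\nu$-integrable and there is an element $r\in E$ such that $\langle e',r\rangle=\int_X\langle e',f(x)\rangle\,d\nu(x)$ for all $e'\in E'$. This element $r$ (unique by Hahn-Banach) is the Pettis integral; only the integral over the whole space $X$ is required to exist in $E$. In the claim, $X=[0,1]$ and $\nu$ is Lebesgue measure. *)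

(* Defs.v *)
From HB Require Import structures.
From mathcomp Require Import all_boot all_order all_algebra.
From mathcomp Require Import all_classical all_reals all_analysis.
Set Implicit Arguments.
Unset Strict Implicit.
Unset Printing Implicit Defensive.
Import Order.TTheory GRing.Theory Num.Theory.
Import numFieldNormedType.Exports.
Local Open Scope classical_set_scope.
Local Open Scope ring_scope.

(* The last clause says that the open balls of the metric [dist] generate the
   given topology of [T].  Nonnegativity of [dist] follows from the others. *)
Definition metrizable (R : realType) (T : topologicalType) : Prop :=
  exists dist : T -> T -> R,
    [/\ forall x y, dist x y = 0 <-> x = y,
        forall x y, dist x y = dist y x,
        forall x y z, dist x z <= dist x y + dist y z &
        forall x, nbhs x = nbhs_ball_ (fun y e => [set z | dist y z < e]) x].

Definition closed_convex_hull (R : realType) (E : tvsType R) (K : set E) :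
    set E :=
  smallest [set A : set E | closed A /\ convex_set A] K.

(* [set_type K] carries the relative topology of [K]. *)
Definition metric_convex_compactness_property (R : realType) (E : tvsType R) :
    Prop :=
  forall K : set E, compact K -> metrizable R (set_type K) ->
    compact (closed_convex_hull K).

Definition is_pettis_integral (R : realType) (E : tvsType R)
    (d : measure_display) (X : measurableType d)
    (nu : {measure set X -> \bar R}) (D : set X) (f : X -> E) (r : E) : Prop :=
  forall phi : {linear E -> R^o}, continuous phi ->
    nu.-integrable D (fun x => (phi (f x))%:E) /\
    phi r = Rintegral nu D (fun x => phi (f x)).

Definition pettis_integrable (R : realType) (E : tvsType R)
    (d : measure_display) (X : measurableType d)
    (nu : {measure set X -> \bar R}) (D : set X) (f : X -> E) : Prop :=
  exists r : E, is_pettis_integral nu D f r.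

(* Main.v *)
(* Necessity: the image of a continuous path f is compact, and metrizable
   because countably many continuous functionals separate its points. Its closed
   convex hull is therefore compact, contains the Riemann sums of f, and any
   cluster point of these sums is the Pettis integral.

   Sufficiency: a compact metrizable K is an image of the Cantor set, and affine
   interpolation over the gaps gives a continuous path f : [0, 1] -> E through
   K. Precompose f with clocks h : [0, 1] -> [0, 1] of Lipschitz constant 2. They
   form a compact set for pointwise convergence, on which h |-> \int f o h is
   continuous by Hahn-Banach separation, so the points 2 \int f o h - \int f form
   a compact set. Running through [0, 1] at speed 2 takes time 1/2, and spending
   the time l_i / 2 at t_i, where \sum l_i = 1, uses up the rest; the
   corresponding point is \sum l_i f(t_i). Hence this compact set contains the
   convex hull of K. *)
Require Import Defs.
From HB Require Import structures.
From mathcomp Require Import all_boot all_order all_algebra.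
From mathcomp Require Import all_classical all_reals all_analysis.
From mathcomp Require Import ring lra.
Set Implicit Arguments.
Unset Strict Implicit.
Unset Printing Implicit Defensive.
Import Order.TTheory GRing.Theory Num.Theory.
Import numFieldNormedType.Exports.
Local Open Scope classical_set_scope.
Local Open Scope ring_scope.

(** * The Hahn-Banach theorem *)

Definition sublinear (R : realType) (V : lmodType R) (p : V -> R) : Prop :=
  (forall x y, p (x + y) <= p x + p y) /\
  (forall t x, 0 < t -> p (t *: x) <= t * p x).

Section sublinear.
Context (R : realType) (V : lmodType R).
Implicit Types (p q : V -> R) (x y : V).

Lemma sublinearZ p t x : sublinear p -> 0 < t -> p (t *: x) = t * p x.
Proof.
move=> [_ pZ] t0; apply/eqP; rewrite eq_le pZ//=.
have := pZ t^-1 (t *: x); rewrite scalerA mulVf ?gt_eqF// scale1r invr_gt0 => /(_ t0).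
by rewrite ler_pdivlMl.
Qed.

Lemma sublinear0 p : sublinear p -> p 0 = 0.
Proof.
move=> sp; have := @sublinearZ p 2 0 sp; rewrite scaler0 => /(_ ltac:(lra)).
lra.
Qed.

Lemma sublinear_geN p x : sublinear p -> - p (- x) <= p x.
Proof.
move=> sp; have := sp.1 x (- x); rewrite subrr sublinear0//.
lra.
Qed.

(* The largest sublinear functional [q <= p] with [q (- y) <= - p y]. *)
Definition sublinear_tilt p y x : R :=
  inf [set r | exists2 t, 0 <= t & r = p (x + t *: y) - t * p y].

(** For [0 < t] one has [t * p y = p (t *: y) <= p (x + t *: y) + p (- x)]; the infimum defining the
    tilt is therefore finite. *)
Lemma sublinear_tilt_lbound p y x : sublinear p ->
  lbound [set r | exists2 t, 0 <= t & r = p (x + t *: y) - t * p y] (- p (- x)).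
Proof.
move=> sp _ [t t0 ->].
have : t * p y <= p (x + t *: y) + p (- x).
  have [->|tN0] := eqVneq t 0.
    rewrite mul0r scale0r addr0; have := sublinear_geN x sp; lra.
  rewrite -sublinearZ ?lt_neqAle ?(eq_sym 0) ?tN0//.
  have := sp.1 (x + t *: y) (- x).
  by rewrite [x + _]addrC addrK.
lra.
Qed.

Lemma sublinear_tilt_le p y x t : sublinear p -> 0 <= t ->
  sublinear_tilt p y x <= p (x + t *: y) - t * p y.
Proof.
move=> sp t0; apply: ge_inf; last by exists t.
by exists (- p (- x)); exact: sublinear_tilt_lbound.
Qed.

Lemma sublinear_tilt_ge p y x r :
  (forall t, 0 <= t -> r <= p (x + t *: y) - t * p y) ->
  r <= sublinear_tilt p y x.
Proof.
move=> rp; apply: lb_le_inf.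
  by exists (p (x + 0 *: y) - 0 * p y); exists 0.
by move=> _ [t t0 ->]; exact: rp.
Qed.

Lemma sublinear_tiltP p y : sublinear p -> sublinear (sublinear_tilt p y).
Proof.
move=> sp; split=> [x1 x2|s x s0].
  rewrite -lerBlDr; apply: sublinear_tilt_ge => t1 t10.
  rewrite lerBlDr -lerBlDl; apply: sublinear_tilt_ge => t2 t20.
  rewrite lerBlDl.
  apply: (le_trans (sublinear_tilt_le y (x1 + x2) sp (addr_ge0 t10 t20))).
  have := sp.1 (x1 + t1 *: y) (x2 + t2 *: y).
  rewrite addrACA -scalerDl; lra.
rewrite mulrC -ler_pdivrMr//; apply: sublinear_tilt_ge => t t0.
rewrite ler_pdivrMr//.
apply: (le_trans (sublinear_tilt_le y (s *: x) sp (mulr_ge0 (ltW s0) t0))).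
rewrite -scalerA -scalerDr sublinearZ//; lra.
Qed.

Lemma sublinear_tilt_le_id p y x : sublinear p -> sublinear_tilt p y x <= p x.
Proof.
move=> sp; have := sublinear_tilt_le y x sp (lexx 0).
by rewrite scale0r addr0 mul0r subr0.
Qed.

(** Zorn's lemma for the reversed pointwise order. A nonempty chain is bounded by its pointwise
    infimum, which is finite because each member is at least [- p (- x)] at [x]. *)
Lemma exists_minimal_sublinear p : sublinear p ->
  exists q, [/\ sublinear q, forall x, q x <= p x &
    forall q', sublinear q' -> (forall x, q' x <= q x) -> q' = q].
Proof.
move=> sp; pose T := {q | sublinear q /\ forall x, q x <= p x}.
pose below (f g : T) := `[< forall x, sval g x <= sval f x >].
have [f|f g h|f g|A totA|[q [sq qp]] qmin] := @Zorn T below.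
- by apply/asboolP.
- move=> /asboolP fg /asboolP gh; apply/asboolP => x.
  exact: le_trans (gh x) (fg x).
- case: f g => [f Pf] [g Pg] /asboolP/= fg /asboolP/= gf; apply: eq_exist.
  by apply/funext => x; apply/eqP; rewrite eq_le fg gf.
- have [[f0 Af0]|A0] := pselect (exists f, A f); last first.
    exists (exist _ p (conj sp (fun x => lexx (p x)))) => f Af.
    by exfalso; apply: A0; exists f.
  pose q x := inf [set sval f x | f in A].
  have qlb x : has_lbound [set sval f x | f in A].
    exists (- p (- x)) => _ [[f [sf fp]] _ <-] /=.
    by rewrite (le_trans _ (sublinear_geN x sf))// lerN2.
  have qle f x : A f -> q x <= sval f x.
    by move=> Af; apply: ge_inf => //; exists f.
  have qge r x : (forall f, A f -> r <= sval f x) -> r <= q x.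
    move=> rf; apply: lb_le_inf; first by exists (sval f0 x); exists f0.
    by move=> _ [f Af <-]; exact: rf.
  have sq : sublinear q.
    split=> [x y|t x t0].
      rewrite -lerBlDr; apply: (qge) => f Af; rewrite lerBlDr -lerBlDl.
      apply: (qge) => g Ag; rewrite lerBlDl.
      (* Members of the chain are comparable, and the smaller of [f] and [g] already bounds
         [q (x + y)] by [f x + g y]. *)
      have [/asboolP fg|/asboolP gf] := totA f g Af Ag.
        rewrite (le_trans (qle g _ Ag))//.
        by rewrite (le_trans ((svalP g).1.1 x y))// lerD2r.
      rewrite (le_trans (qle f _ Af))//.
      by rewrite (le_trans ((svalP f).1.1 x y))// lerD2l.
    rewrite mulrC -ler_pdivrMr//; apply: (qge) => f Af; rewrite ler_pdivrMr//.
    by rewrite (le_trans (qle f _ Af))// mulrC (svalP f).1.2.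
  have qp x : q x <= p x by rewrite (le_trans (qle f0 x Af0))// (svalP f0).2.
  by exists (exist _ q (conj sq qp)) => f Af; apply/asboolP => x; exact: qle.
exists q; split=> // q' sq' q'q.
have q'p x : q' x <= p x by exact: le_trans (q'q x) (qp x).
by have /(_ ltac:(exact/asboolP))/(congr1 sval) := qmin (exist _ q' (conj sq' q'p)).
Qed.

(** By minimality [q] equals its tilt at [y]; the parameter 1 in that tilt gives
    [q x <= q (x + y) - q y]. *)
Lemma minimal_sublinear_additive q : sublinear q ->
  (forall q', sublinear q' -> (forall x, q' x <= q x) -> q' = q) ->
  forall x y, q (x + y) = q x + q y.
Proof.
move=> sq qmin x y; apply/eqP; rewrite eq_le sq.1/=.
have tiltE : sublinear_tilt q y = q.
  by apply: qmin => [|z]; [exact: sublinear_tiltP|exact: sublinear_tilt_le_id].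
have := sublinear_tilt_le y x sq ler01.
by rewrite tiltE scale1r mul1r lerBrDr.
Qed.

(** A minimal sublinear functional below the tilt of [p] at [x0] is linear. The tilt at [- x0] is at
    most [p 0 - p x0 = - p x0], which forces [p x0 <= phi x0]. *)
Theorem hahn_banach p x0 : sublinear p ->
  exists phi : {linear V -> R^o}, (forall x, phi x <= p x) /\ phi x0 = p x0.
Proof.
move=> sp; have st := sublinear_tiltP x0 sp.
have [q [sq qt qmin]] := exists_minimal_sublinear st.
have qD := minimal_sublinear_additive sq qmin.
have q0 := sublinear0 sq.
have qN x : q (- x) = - q x by apply/eqP; rewrite -addr_eq0 -qD addNr q0.
have qZ (t : R) x : q (t *: x) = t * q x.
  have [t0|t0|->] := ltgtP t 0; last by rewrite scale0r mul0r q0.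
    rewrite -[t in LHS]opprK scaleNr -scalerN sublinearZ// ?oppr_gt0//.
    by rewrite qN mulrNN.
  exact: sublinearZ.
have linq : linear (q : V -> R^o) by move=> t x y; rewrite qD qZ.
pose Q := GRing.isLinear.Build R V R^o *:%R (q : V -> R^o) linq.
pose phi : {linear V -> R^o} := HB.pack (q : V -> R^o) Q.
have phip x : phi x <= p x by exact: le_trans (qt x) (sublinear_tilt_le_id x0 x sp).
exists phi; split=> //; apply/eqP; rewrite eq_le phip/=.
have := le_trans (qt (- x0)) (sublinear_tilt_le x0 (- x0) sp ler01).
by rewrite qN scale1r addNr sublinear0// mul1r sub0r lerN2.
Qed.

End sublinear.

(** * Locally convex spaces *)

Section convexity.
Context (R : realType) (V : lmodType R).

Lemma convex_setE (A : set V) : convex_set A <->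
  forall x y (t : R), 0 <= t -> t <= 1 -> A x -> A y ->
    A (t *: x + (1 - t) *: y).
Proof.
split=> [cA x y t t0 t1 Ax Ay|cA x y t /set_mem Ax /set_mem Ay].
  have t01 : Itv.spec (@Itv.num_sem R) (Itv.Real `[0%Z, 1%Z]) t.
    by apply/and3P; split; rewrite //= ?num_real// in_itv/= t0 t1.
  apply/set_mem; exact: (cA x y (Itv.mk t01) (mem_set Ax) (mem_set Ay)).
by apply/mem_set; apply: cA.
Qed.

End convexity.

Section tvs.
Context (R : realType) (E : tvsType R).

Section cvg.
Context (T : Type) (F : set_system T) (FF : Filter F).

Lemma tvs_cvgD (f g : T -> E) (a b : E) :
  f @ F --> a -> g @ F --> b -> f x + g x @[x --> F] --> a + b.
Proof.
by move=> fa gb; apply: continuous2_cvg fa gb; exact: (@add_continuous E (a, b)).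
Qed.

Lemma tvs_cvgB (f g : T -> E) (a b : E) :
  f @ F --> a -> g @ F --> b -> f x - g x @[x --> F] --> a - b.
Proof.
by move=> fa gb; apply: (@continuous2_cvg _ _ _ _ _ _ f g (fun x y => x - y)) fa gb;
  exact: (@sub_continuous E (a, b)).
Qed.

Lemma tvs_cvgZ (k : T -> R) (f : T -> E) (c : R) (a : E) :
  k @ F --> c -> f @ F --> a -> k x *: f x @[x --> F] --> c *: a.
Proof.
move=> kc fa.
by apply: (@continuous2_cvg _ R^o E E F _ k f (fun x y => x *: y) c a) kc fa;
  exact: (@scale_continuous R E (c, a)).
Qed.

End cvg.

Lemma nbhs0_convex (U : set E) : nbhs 0 U ->
  exists V : set E, [/\ nbhs 0 V, convex_set V & V `<=` U].
Proof.
move=> U0; have [B Bconv [Bopen Bbasis]] := @locally_convex R E.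
have [V [BV V0] VU] := Bbasis 0 U U0.
exists V; split=> //; last exact/Bconv/mem_set.
by apply: open_nbhs_nbhs; split=> //; exact: Bopen.
Qed.

(** An upper bound is enough: applied to [e^-1 *: (x - y)] and to its opposite, it gives both halves
    of the estimate of [phi x - phi y] by [e]. *)
Lemma linear_le1_continuous (phi : {linear E -> R^o}) (U : set E) :
  nbhs 0 U -> (forall u, U u -> phi u <= 1) -> continuous phi.
Proof.
move=> U0 phiU x; apply/(@cvgrPdist_le _ R^o) => e e0.
have small (c : R) : \forall y \near x, U (c *: (x - y)).
  have : c *: (x - y) @[y --> x] --> (0 : E).
    rewrite -(scaler0 _ c) -(subrr x); apply: tvs_cvgZ; first exact: cvg_cst.
    by apply: tvs_cvgB; [exact: cvg_cst|exact: cvg_id].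
  exact.
near=> y; rewrite -linearB ler_norml; apply/andP; split.
  have /phiU : U ((- e^-1) *: (x - y)) by near: y; exact: small.
  by rewrite linearZ/= /GRing.scale/= mulNr lerNl ler_pdivlMl// mulrN1.
have /phiU : U (e^-1 *: (x - y)) by near: y; exact: small.
by rewrite linearZ/= /GRing.scale/= ler_pdivrMl// mulr1.
Unshelve. all: by end_near. Qed.

(** * Minkowski functionals and separation from a convex neighbourhood of 0 *)

Definition gauge (U : set E) (x : E) : R :=
  inf [set t | 0 < t /\ U (t^-1 *: x)].

Section gauge.
Context (U : set E) (U0 : nbhs 0 U) (cU : convex_set U).

Lemma gauge_nonempty x : [set t : R | 0 < t /\ U (t^-1 *: x)] !=set0.
Proof.
have : t *: x @[t --> (0 : R)] --> (0 : E).
  by rewrite -[X in _ --> X](scale0r x); apply: tvs_cvgZ; [exact: cvg_id|exact: cvg_cst].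
move=> /(_ U U0) [e /= e0 eU]; exists (e / 2)^-1.
rewrite /= invrK invr_gt0 divr_gt0//; split=> //; apply: eU => /=.
by rewrite sub0r normrN gtr0_norm ?divr_gt0// ltr_pdivrMr// ltr_pMr// ltr1n.
Qed.

Lemma gauge_le x t : 0 < t -> U (t^-1 *: x) -> gauge U x <= t.
Proof. by move=> t0 Ux; apply: ge_inf => //; exists 0 => ? [/ltW]. Qed.

Lemma gauge_ge x r : (forall t, 0 < t -> U (t^-1 *: x) -> r <= t) ->
  r <= gauge U x.
Proof.
by move=> xr; apply: lb_le_inf; [exact: gauge_nonempty|move=> t []; exact: xr].
Qed.

(** A [t < 1] with [t^-1 *: x] in [U] would put [x] into [U], as a convex combination of [t^-1 *: x]
    and 0. *)
Lemma gauge_ge1 x : ~ U x -> 1 <= gauge U x.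
Proof.
move=> Ux; apply: gauge_ge => t t0 tx; rewrite leNgt; apply/negP => t1.
apply: Ux.
have := (convex_setE U).1 cU _ 0 t (ltW t0) (ltW t1) tx (nbhs_singleton U0).
by rewrite scaler0 addr0 scalerA divff ?gt_eqF// scale1r.
Qed.

Lemma gauge_sublinear : sublinear (gauge U).
Proof.
split=> [x y|t x t0].
  rewrite -lerBlDr; apply: gauge_ge => s s0 sx.
  rewrite lerBlDr -lerBlDl; apply: gauge_ge => t t0 ty.
  rewrite lerBlDl; apply: gauge_le; first exact: addr_gt0.
  have st0 : s + t != 0 by rewrite gt_eqF// addr_gt0.
  (* With this weight the convex combination of [s^-1 *: x] and [t^-1 *: y] is
     [(s + t)^-1 *: (x + y)]. *)
  have := (convex_setE U).1 cU _ _ (s / (s + t)) _ _ sx ty.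
  rewrite !scalerA mulrAC divff ?gt_eqF// mul1r.
  have -> : (1 - s / (s + t)) / t = (s + t)^-1 by field; rewrite ?st0 ?gt_eqF//.
  rewrite -scalerDr; apply.
    by rewrite divr_ge0// ltW// addr_gt0.
  by rewrite ler_pdivrMr ?addr_gt0// mul1r lerDl ltW.
rewrite mulrC -ler_pdivrMr//; apply: gauge_ge => s s0 sx.
rewrite ler_pdivrMr//; apply: gauge_le; first exact: mulr_gt0.
by rewrite scalerA invfM -mulrA mulVf ?gt_eqF// mulr1.
Qed.

(** Hahn-Banach for the gauge of [U] at [r]: [phi] lies below the gauge, hence is at most 1 on [U],
    and agrees with it at [r], where it is at least 1. *)
Lemma separation_convex_nbhs r : ~ U r ->
  exists phi : {linear E -> R^o},
    [/\ continuous phi, forall u, U u -> phi u <= 1 & 1 <= phi r].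
Proof.
move=> Ur; have [phi [phile phir]] := hahn_banach r gauge_sublinear.
have phi1 u : U u -> phi u <= 1.
  by move=> Uu; apply: (le_trans (phile u)); apply: gauge_le => //; rewrite invr1 scale1r.
exists phi; split=> //; first exact: linear_le1_continuous U0 phi1.
by rewrite phir; exact: gauge_ge1.
Qed.

End gauge.

Lemma continuous_linear_separates (hE : hausdorff_space E) (x y : E) :
  (forall phi : {linear E -> R^o}, continuous phi -> phi x = phi y) -> x = y.
Proof.
move=> phixy; apply: contrapT => xy.
have [U [U0 Uxy]] : exists U, nbhs (0 : E) U /\ ~ U (x - y).
  (* Otherwise [x = y + (x - y)] would lie in every neighbourhood of [y], against the Hausdorff
     property. *)
  apply: contrapT => noU; apply: xy; apply: hE => A B Ax By.
  have By0 : nbhs 0 [set u | B (y + u)].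
    suff : y + u @[u --> (0 : E)] --> y by exact.
    rewrite -[X in _ --> X]addr0.
    by apply: tvs_cvgD; [exact: cvg_cst|exact: cvg_id].
  exists x; split; first exact: nbhs_singleton.
  apply: contrapT => Bx; apply: noU; exists [set u | B (y + u)]; split=> //=.
  by rewrite addrC subrK.
have [V [V0 cV VU]] := nbhs0_convex U0.
have /(separation_convex_nbhs V0 cV)[phi [cphi _]] : ~ V (x - y) by move=> /VU.
by rewrite linearB/= (phixy phi cphi) subrr ler10.
Qed.

End tvs.

(** * Integrals of continuous real functions *)

Section integral.
Context (R : realType).
Implicit Types (u F : R -> R) (a b c k l x : R).

Local Notation "'\I[' a , b ] u" :=
  (\int[@lebesgue_measure R]_(x in `[a, b]) u x)
  (at level 36, u at level 36, format "'\I[' a ,  b ]  u").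

Lemma continuous_integrable u a b : continuous u ->
  (@lebesgue_measure R).-integrable `[a, b] (EFin \o u).
Proof.
move=> cu; apply: continuous_compact_integrable; first exact: segment_compact.
exact: continuous_subspaceT.
Qed.

(** The derivative is obtained strictly to the right of [a]; later uses start one unit to the left
    of the interval, so that its left endpoint is covered. *)
Lemma exists_primitive u a : continuous u ->
  exists F, forall x, a < x -> is_derive x 1 F (u x).
Proof.
move=> cu; exists (fun y => \I[a, y] u) => x ax.
have xx1 : x < x + 1 by rewrite ltrDl.
have [dF F'] := continuous_FTC1_closed xx1 (continuous_integrable a (x + 1) cu) ax (cu x).
by apply: DeriveDef; [exact: dF|rewrite -derive1E; exact: F'].
Qed.

Lemma integral_primitive u F a b : a <= b -> continuous u ->
  (forall x, a <= x -> x <= b -> is_derive x 1 F (u x)) ->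
  \I[a, b] u = F b - F a.
Proof.
rewrite le_eqVlt => /predU1P[<- _ _|ab cu dF].
  by rewrite set_itv1 Rintegral_set1 subrr.
have cF x : a <= x -> x <= b -> {for x, continuous F}.
  move=> ax xb; have [dFx _] := dF x ax xb.
  exact/differentiable_continuous/derivable1_diffP.
rewrite /Rintegral (@continuous_FTC2 _ u F)//.
- exact: continuous_subspaceT.
- split.
  + by move=> x; rewrite in_itv/= => /andP[/ltW ax /ltW xb]; have [] := dF x ax xb.
  + by apply: cvg_at_right_filter; apply: cF => //; exact: ltW.
  + by apply: cvg_at_left_filter; apply: cF => //; exact: ltW.
- move=> x; rewrite in_itv/= => /andP[/ltW ax /ltW xb].
  by rewrite derive1E; have [_ ->] := dF x ax xb.
Qed.

Lemma integral_split u a c b : a <= c -> c <= b -> continuous u ->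
  \I[a, b] u = \I[a, c] u + \I[c, b] u.
Proof.
move=> ac cb cu; have [F dF] := exists_primitive (a - 1) cu.
have dF' x : a <= x -> is_derive x 1 F (u x).
  by move=> ax; apply: dF; rewrite ltrBlDr ltr_pwDr.
have IE x y : a <= x -> x <= y -> \I[x, y] u = F y - F x.
  move=> ax xy; apply: integral_primitive => // z xz _.
  by apply: dF'; exact: le_trans xz.
by rewrite !IE// ?(le_trans ac)//; ring.
Qed.

Lemma integral_affine u k l a b : 0 < k -> a <= b -> continuous u ->
  \I[a, b] (fun x => u (k * x + l)) = k^-1 * \I[k * a + l, k * b + l] u.
Proof.
move=> k0 ab cu; have [F dF] := exists_primitive (k * a + l - 1) cu.
have dF' x : k * a + l <= x -> is_derive x 1 F (u x).
  by move=> ax; apply: dF; rewrite ltrBlDr ltr_pwDr.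
have kaff x y : x <= y -> k * x + l <= k * y + l.
  by move=> xy; rewrite lerD2r ler_pM2l.
have -> : \I[k * a + l, k * b + l] u = F (k * b + l) - F (k * a + l).
  by apply: integral_primitive => // [|x ax _]; [exact: kaff|exact: dF'].
rewrite mulrBr.
apply: (@integral_primitive _ (fun x => k^-1 * F (k * x + l))) => //.
- move=> x; apply: continuous_comp; last exact: cu.
  by apply: cvgD; [apply: cvgM; [exact: cvg_cst|exact: cvg_id]|exact: cvg_cst].
- move=> x ax xb; have dFx := dF' _ (kaff _ _ ax).
  have daff : is_derive x 1 (fun x => k * x + l : R) k.
    by by apply: is_derive_eq; rewrite addr0 /GRing.scale/= mulr1.
  have := @is_deriveZ _ _ _ _ k^-1 _ _ _
    (@is_derive1_comp _ F (fun x => k * x + l) _ _ _ dFx daff).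
  by rewrite /GRing.scale/= mulrCA mulVf ?gt_eqF// mulr1.
Qed.

Lemma integral_const r a b : a <= b -> \I[a, b] (fun=> r) = r * (b - a).
Proof.
move=> ab; rewrite mulrBr.
apply: (@integral_primitive (fun=> r) (fun x => r * x)) => // [x|x _ _].
  exact: cvg_cst.
by apply: is_derive_eq; rewrite /GRing.scale/= mulr1.
Qed.

Lemma eq_integral_itv u v a b : (forall x, a <= x -> x <= b -> u x = v x) ->
  \I[a, b] u = \I[a, b] v.
Proof.
move=> uv; apply: eq_Rintegral => x; rewrite inE/= in_itv/= => /andP[].
exact: uv.
Qed.

Lemma lipschitz_continuous_real (u : R -> R) k :
  (forall x y, `|u x - u y| <= k * `|x - y|) -> continuous u.
Proof.
move=> ku x; apply/cvgrPdist_le => e e0; near=> y.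
rewrite (le_trans (ku x y))// (@le_trans _ _ ((`|k| + 1) * `|x - y|))//.
  by rewrite ler_wpM2r// (le_trans (ler_norm k))// lerDl.
rewrite -ler_pdivlMl ?ltr_wpDl//; near: y; apply: cvgr_dist_le => //.
by rewrite mulr_gt0// invr_gt0 ltr_wpDl.
Unshelve. all: by end_near. Qed.

(* A clock that stops at [c] during a time [l]. *)
Definition stop c l s : R := Num.min s (Num.max c (s - l)).

Lemma stop_lipschitz c l s t : `|stop c l s - stop c l t| <= `|s - t|.
Proof.
wlog st : s t / s <= t.
  by move=> H; have [/H//|/ltW/H] := leP s t; rewrite distrC [leRHS]distrC.
rewrite distrC [leRHS]distrC [leRHS]ger0_norm ?subr_ge0// /stop.
rewrite ler_norml.
case: (leP c (s - l)) => ?; case: (leP c (t - l)) => ?;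
  [case: (leP s (s - l)) => ?; case: (leP t (t - l)) => ?
  |case: (leP s (s - l)) => ?; case: (leP t c) => ?
  |case: (leP s c) => ?; case: (leP t (t - l)) => ?
  |case: (leP s c) => ?; case: (leP t c) => ?]; apply/andP; split; lra.
Qed.

(** The integral is cut at [c] and [c + l]: the clock is the identity before [c], rests at [c] in
    between, and lags by [l] afterwards. *)
Lemma integral_stop u c l T : 0 <= c -> c <= T -> 0 <= l -> continuous u ->
  \I[0, T + l] (fun s => u (stop c l s)) = \I[0, T] u + l * u c.
Proof.
move=> c0 cT l0 cu.
have cstop : continuous (fun s => u (stop c l s)).
  move=> s; apply: continuous_comp; last exact: cu.
  by apply: (@lipschitz_continuous_real _ 1) => x y; rewrite mul1r stop_lipschitz.
have E1 : \I[0, c] (fun s => u (stop c l s)) = \I[0, c] u.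
  apply: eq_integral_itv => s s0 sc; congr u.
  rewrite /stop (max_idPl _) ?(min_idPl _)//.
  by rewrite lerBlDr (le_trans sc)// lerDl.
have E2 : \I[c, c + l] (fun s => u (stop c l s)) = l * u c.
  rewrite (@eq_integral_itv _ (fun=> u c)) ?integral_const ?lerDl//.
    by rewrite addrAC subrr add0r mulrC.
  move=> s cs sl; congr u; rewrite /stop (max_idPl _) ?lerBlDr//.
  by rewrite (min_idPr _).
have E3 : \I[c + l, T + l] (fun s => u (stop c l s)) = \I[c, T] u.
  have := @integral_affine u 1 (- l) (c + l) (T + l).
  rewrite !mul1r !addrK invr1 mul1r => <-//; last by rewrite lerD2r.
  apply: eq_integral_itv => s sc _; congr u; rewrite mul1r.
  by rewrite /stop (max_idPr _) ?lerBrDr// (min_idPr _)// gerDl oppr_le0.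
have cTl : c <= T + l by rewrite (le_trans cT)// lerDl.
rewrite (integral_split c0 cTl)//.
rewrite (@integral_split _ c (c + l) (T + l))//; [|by rewrite lerDl|by rewrite lerD2r].
by rewrite (integral_split c0 cT)// E1 E2 E3; ring.
Qed.

End integral.

(* The uniform structure of a [tvsType] generates the topology but need not be
   translation invariant, hence this formulation by neighbourhoods of 0. *)
Lemma tvs_uniformly_continuous_itv01 (R : realType) (E : tvsType R)
    (f : R -> E) (U : set E) : continuous f -> nbhs 0 U ->
  exists2 d : R, 0 < d & forall x y : R, 0 <= x -> x <= 1 -> `|x - y| < d ->
    U (f x - f y).
Proof.
move=> cf U0.
have /compact_near_coveringP cpt := @segment_compact R 0 1.
have := cpt R 0^'+ (fun d x => forall y, `|x - y| < d -> U (f x - f y)) _.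
case=> [x0 _|d /= d0 dP].
  have : f z.1 - f z.2 @[z --> (x0, x0)] --> (0 : E).
    rewrite -(subrr (f x0)); apply: tvs_cvgB.
      by apply: (@continuous_comp _ _ _ fst f (x0, x0)); [exact: cvg_fst|exact: cf].
    by apply: (@continuous_comp _ _ _ snd f (x0, x0)); [exact: cvg_snd|exact: cf].
  move=> /(_ _ U0)[[A B] [/= Ax Bx] ABU].
  have [e /= e0 eAB] : nbhs_ball x0 (A `&` B) by apply/nbhs_ballP; exact: filterI.
  exists (ball x0 (e / 2), [set d | d < e / 2]) => /=.
    split; first by apply: nbhsx_ballx; rewrite divr_gt0.
    by apply: nbhs_right_lt; rewrite divr_gt0.
  move=> [x d] /= [x0x de] y xyd; apply: (ABU (x, y)); split => /=.
    by apply: (eAB x _).1; apply: le_ball x0x; rewrite ler_pdivrMr// ler_pMr// ler1n.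
  apply: (eAB y _).2; rewrite /ball/= in x0x *.
  by rewrite (splitr e) (le_lt_trans (ler_distD x _ _))// ltrD// (lt_trans xyd).
exists (d / 2); first by rewrite divr_gt0.
move=> x y x0 x1; apply: (dP (d / 2)) => /=.
- by rewrite sub0r normrN gtr0_norm ?divr_gt0// ltr_pdivrMr// ltr_pMr// ltr1n.
- by rewrite divr_gt0.
- by rewrite in_itv/= x0 x1.
Qed.

(** On each of the [n.+1] subintervals the mean value theorem turns the increment of a primitive
    into a value of [u] times the length; uniform continuity compares that value with the one at the
    left endpoint. *)
Lemma riemann_sum_cvg (R : realType) (u : R -> R) : continuous u ->
  n.+1%:R^-1 * (\sum_(k < n.+1) u (k%:R / n.+1%:R)) @[n --> \oo] -->
  \int[@lebesgue_measure R]_(x in `[0, 1]) u x.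
Proof.
move=> cu; apply/cvgrPdist_le => e e0.
have [|d d0 du] := @tvs_uniformly_continuous_itv01 R R^o u (ball 0 e) cu.
  exact: nbhsx_ballx.
have [F dF] := exists_primitive (-1) cu.
have dF0 (x : R) : 0 <= x -> is_derive x 1 F (u x).
  by move=> x0; apply: dF; rewrite (lt_le_trans _ x0)// ltrN10.
have -> : \int[@lebesgue_measure R]_(x in `[0, 1]) u x = F 1 - F 0.
  by apply: integral_primitive => // x x0 _; exact: dF0.
near=> n.
have : n.+1%:R^-1 < d :> R by near: n; exact: (near_infty_natSinv_lt (PosNum d0)).
set N : R := n.+1%:R => Nd.
have N0 : 0 < N :> R by rewrite ltr0n.
have stepE k : (k.+1%:R / N - k%:R / N : R) = N^-1.
  by rewrite -mulrBl -natrB// subSnn mul1r.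
have Fk (k : nat) : (k < n.+1)%N ->
    `|F (k.+1%:R / N) - F (k%:R / N) - N^-1 * u (k%:R / N)| <= N^-1 * e.
  move=> kn.
  have k0 : 0 <= k%:R / N :> R by rewrite divr_ge0// ltW.
  have kk1 : k%:R / N <= k.+1%:R / N :> R by rewrite ler_pM2r ?invr_gt0// ler_nat.
  have k1 : k%:R / N <= 1 :> R by rewrite ler_pdivrMr// mul1r ler_nat ltnW.
  have dFk (x : R) : x \in `]k%:R / N, k.+1%:R / N[ -> is_derive x 1 F (u x).
    by rewrite in_itv/= => /andP[kx _]; apply: dF0; rewrite (le_trans k0)// ltW.
  have [|c] := MVT_segment kk1 dFk.
    apply: derivable_within_continuous => x; rewrite in_itv/= => /andP[kx _].
    by have [] := dF0 x (le_trans k0 kx).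
  rewrite in_itv/= => /andP[kc ck] ->.
  rewrite stepE mulrC -mulrBr normrM gtr0_norm ?invr_gt0//.
  rewrite ler_pM2l ?invr_gt0//.
  have := du (k%:R / N) c k0 k1.
  rewrite /ball/= sub0r normrN (distrC (u c)) => H; apply/ltW/H.
  rewrite distrC ger0_norm ?subr_ge0//.
  rewrite (@le_lt_trans _ _ N^-1)//; by rewrite -[leRHS](stepE k) lerD2r.
have -> : F 1 - F 0 = \sum_(k < n.+1) (F (k.+1%:R / N) - F (k%:R / N)).
  have := @telescope_sumr R 0 n.+1 (fun k => F (k%:R / N)) (leq0n _).
  by rewrite big_mkord => ->; rewrite mul0r divff ?gt_eqF.
rewrite mulr_sumr -sumrB (le_trans (ler_norm_sum _ _ _))//.
rewrite (@le_trans _ _ (\sum_(k < n.+1) N^-1 * e))//.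
  by apply: ler_sum => k _; exact: Fk.
by rewrite sumr_const card_ord -[leLHS]mulr_natl mulrA divff ?mul1r ?gt_eqF.
Unshelve. all: by end_near. Qed.

(** * Metrizability *)

Section separating_sequence.
Context (R : realType) (T : topologicalType) (psi : nat -> T -> R).
Hypothesis cpsi : forall n, continuous (psi n).
Hypothesis psi_inj : forall x y, (forall n, psi n x = psi n y) -> x = y.
Hypothesis cptT : compact [set: T].

(** The truncation at [n.+1%:R^-1] makes the supremum [d] finite and all but finitely many terms
    uniformly small, so that a ball of [d] only constrains finitely many [psi n]. *)
Let term x y n : R := Num.min n.+1%:R^-1 `|psi n x - psi n y|.

Let d x y : R := sup (range (term x y)).

Let d_ge x y n : term x y n <= d x y.
Proof.
apply: ub_le_sup; last by exists n.
exists 1 => _ [m _ <-]; rewrite ge_min; apply/orP; left.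
by rewrite invf_le1// ler1n.
Qed.

Let d_le x y r : (forall n, term x y n <= r) -> d x y <= r.
Proof.
move=> xyr; apply: ge_sup; first by exists (term x y 0); exists 0%N.
by move=> _ [n _ <-].
Qed.

Let term_ge0 x y n : 0 <= term x y n.
Proof. by rewrite le_min invr_ge0 ler0n normr_ge0. Qed.

Let d_ge0 x y : 0 <= d x y.
Proof. exact: (le_trans (term_ge0 x y 0%N) (d_ge x y 0%N)). Qed.

Let dC x y : d x y = d y x.
Proof.
by rewrite /d (_ : term x y = term y x)//; apply/funext => n; rewrite /term distrC.
Qed.

Let d0 x y : d x y = 0 <-> x = y.
Proof.
split=> [dxy|->].
  apply: psi_inj => n; apply/eqP; rewrite -subr_eq0 -normr_le0.
  have := d_ge x y n; rewrite dxy /term ge_min => /orP[|//].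
  by rewrite leNgt invr_gt0 ltr0n.
apply/eqP; rewrite eq_le d_ge0 andbT; apply: d_le => n.
by rewrite /term subrr normr0 ge_min lexx orbT.
Qed.

Let d_triangle x y z : d x z <= d x y + d y z.
Proof.
apply: d_le => n; apply: le_trans (lerD (d_ge x y n) (d_ge y z n)).
rewrite /term; set a := _^-1.
have a0 : 0 <= a by rewrite invr_ge0 ler0n.
have := ler_distD (psi n y) (psi n x) (psi n z).
move: (normr_ge0 (psi n x - psi n y)) (normr_ge0 (psi n y - psi n z)).
by case: (leP a `|psi n x - psi n y|); case: (leP a `|psi n y - psi n z|);
  case: (leP a `|psi n x - psi n z|); lra.
Qed.

Let d_nbhs x e : 0 < e -> nbhs x [set z | d x z < e].
Proof.
move=> e0; have e20 : 0 < e / 2 by rewrite divr_gt0.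
have [N _ Ne] := near_infty_natSinv_lt (PosNum e20).
have : \forall z \near x, forall n, (n < N)%N -> `|psi n x - psi n z| < e / 2.
  elim: N {Ne} => [|N IH]; first by apply: nearW.
  near=> z => n; rewrite ltnS leq_eqVlt => /predU1P[->|].
    by near: z; apply: cvgr_dist_lt => //; exact: cpsi.
  by move: n; near: z.
apply: filterS => z zx /=; rewrite (@le_lt_trans _ _ (e / 2))//.
  apply: d_le => n; rewrite /term ge_min; have [nN|Nn] := ltnP n N.
    by rewrite (ltW (zx n nN)) orbT.
  by have /= /ltW -> := Ne n Nn.
by rewrite ltr_pdivrMr// ltr_pMr// ltr1n.
Unshelve. all: by end_near. Qed.

(** Balls are neighbourhoods by continuity of the [psi n]. Conversely, given a neighbourhood [A] of
    [x], each [z <> x] has a neighbourhood at distance more than [d x z / 2] from [x], and [A]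
    itself serves near [x]; compactness yields one radius for all points. *)
Lemma compact_separated_metrizable : metrizable R T.
Proof.
exists d; split=> // x; apply/seteqP; split=> A; last first.
  by move=> [e /= e0 eA]; exact: filterS eA (d_nbhs x e0).
move=> xA.
have /compact_near_coveringP cpt := cptT.
have := cpt R 0^'+ (fun e z => d x z < e -> A z) _.
case=> [z _|e /= e0 eA].
  have [xz|xz] := eqVneq (d x z) 0.
    move: xz => /d0 xz; rewrite -{}xz; exists (A, setT) => /=.
      by split => //; exact: filterT.
    by move=> [y e] [].
  have dxz : 0 < d x z by rewrite lt_neqAle eq_sym xz d_ge0.
  have dxz2 : 0 < d x z / 2 by rewrite divr_gt0.
  exists ([set y | d z y < d x z / 2], [set e | e < d x z / 2]) => /=.
    by split; [exact: d_nbhs|exact: nbhs_right_lt].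
  move=> [y e] /= [zy ed] xy; exfalso.
  by have := d_triangle x y z; rewrite (dC y z); lra.
exists (e / 2); first by rewrite /= divr_gt0.
move=> z /= xz; apply: (eA (e / 2) _ _ z) xz => //=.
- by rewrite sub0r normrN gtr0_norm ?divr_gt0// ltr_pdivrMr// ltr_pMr// ltr1n.
- by rewrite divr_gt0.
Qed.

End separating_sequence.

Lemma compact_set_type (T : topologicalType) (K : set T) :
  compact K -> compact [set: set_type K].
Proof.
move=> cK F FF _.
have FK : (set_val @ F) K.
  by apply: (@filterS _ F _ setT) filterT => x _; apply/set_mem; exact: (valP x).
have [p [Kp pF]] := cK (set_val @ F) _ FK.
exists (exist _ p (mem_set Kp)); split=> // A B FA.
rewrite nbhsE => -[_ [[V oV <-] Vp] VB].
have FA' : (set_val @ F) (set_val @` A).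
  by apply: (@filterS _ F _ A) FA => x Ax; exists x.
have pV : nbhs p V by apply: open_nbhs_nbhs; split=> //; exact: Vp.
have [_ [[x Ax <-] Vx]] := pF _ _ FA' pV.
by exists x; split=> //; exact: VB.
Qed.

(** * Metrizability of the image of a path *)

Section path.
Context (R : realType) (E : tvsType R) (hE : hausdorff_space E) (f : R -> E).
Hypothesis cf : continuous f.

(** The index codes two rational centres and a radius, so there are countably many boxes; one
    functional chosen for each box will separate the points of the image. *)
Let separates (i : rat * rat * nat) (phi : {linear E -> R^o}) : Prop :=
  continuous phi /\ forall s t : R, `|s - ratr i.1.1| < i.2.+1%:R^-1 ->
    `|t - ratr i.1.2| < i.2.+1%:R^-1 -> phi (f s) <> phi (f t).

Let exists_separating_box s t : f s <> f t -> exists i phi,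
  [/\ separates i phi, `|s - ratr i.1.1| < i.2.+1%:R^-1 &
    `|t - ratr i.1.2| < i.2.+1%:R^-1].
Proof.
move=> fst.
have [phi [cphi phist]] : exists phi : {linear E -> R^o},
    continuous phi /\ phi (f s) != phi (f t).
  apply: contrapT => nophi; apply: fst.
  apply: (continuous_linear_separates hE) => phi cphi.
  by apply: contrapT => /eqP phist; apply: nophi; exists phi.
have cpf x : phi (f y) @[y --> x] --> phi (f x).
  by apply: (@continuous_comp _ _ _ f phi); [exact: cf|exact: cphi].
pose e := `|phi (f s) - phi (f t)| / 2.
have e0 : 0 < e by rewrite divr_gt0// normr_gt0 subr_eq0.
have [d1 /= d10 sd1] := (cvgrPdist_lt _ _).1 (cpf s) e e0.
have [d2 /= d20 td2] := (cvgrPdist_lt _ _).1 (cpf t) e e0.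
(* Half, because two points within the radius of a common centre may be twice the radius apart. *)
have d0 : 0 < Num.min d1 d2 / 2 by rewrite divr_gt0// lt_min d10.
have [m _ /(_ m (leqnn _)) /= md] := near_infty_natSinv_lt (PosNum d0).
have m0 : 0 < m.+1%:R^-1 :> R by rewrite invr_gt0.
have approx (x : R) : exists q : rat, `|x - ratr q| < m.+1%:R^-1.
  have xm : x < x + m.+1%:R^-1 by rewrite ltrDl.
  have [q] := rat_in_itvoo xm; rewrite in_itv/= => /andP[xq qx].
  by exists q; rewrite distrC gtr0_norm ?subr_gt0// ltrBlDl.
have [p sp] := approx s; have [q tq] := approx t.
exists (p, q, m), phi; split=> //; split=> //= s' t' s'p t'q phist'.
have near_lt (x y z : R) : `|x - z| < m.+1%:R^-1 -> `|y - z| < m.+1%:R^-1 ->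
    `|x - y| < Num.min d1 d2.
  move=> xz yz; rewrite (splitr (Num.min d1 d2)).
  rewrite (le_lt_trans (ler_distD z _ _))// ltrD ?(lt_trans _ md)//.
  by rewrite distrC.
have := near_lt _ _ _ sp s'p; rewrite lt_min => /andP[/sd1 ss' _].
have := near_lt _ _ _ tq t'q; rewrite lt_min => /andP[_ /td2 tt'].
have := ler_distD (phi (f s')) (phi (f s)) (phi (f t)).
move: ss' tt'; rewrite phist' (distrC (phi (f t))) /e.
set a := `|_|; set b := `|_|; set c := `|_|; lra.
Qed.

Lemma compact_path_image : compact (f @` `[0, 1]).
Proof.
apply: continuous_compact; first exact: continuous_subspaceT.
exact: segment_compact.
Qed.

Lemma metrizable_path_image : metrizable R (set_type (f @` `[0, 1])).
Proof.
(* The chosen functional of the box coded by [n]; it is replaced by the constant 0 if [n] codes no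
   box or the box has no separating functional. *)
pose psi n (x : set_type (f @` `[0, 1])) : R :=
  if unpickle n is Some i then
    if pselect (exists phi, separates i phi) is left H
    then projT1 (cid H) (set_val x) else 0
  else 0.
apply: (@compact_separated_metrizable R _ psi).
- move=> n x; rewrite /psi; case: unpickle => [i|]; last exact: cst_continuous.
  case: pselect => [H|_]; last exact: cst_continuous.
  have [cphi _] := projT2 (cid H).
  apply: (@continuous_comp _ _ _ set_val (projT1 (cid H))).
    exact: initial_continuous.
  exact: cphi.
- move=> x y psixy; apply/val_inj => /=.
  have /set_mem[s _ fs] := valP x; have /set_mem[t _ ft] := valP y.
  apply: contrapT => xy.
  have [i [phi [sepi si ti]]] : exists i phi, [/\ separates i phi,
      `|s - ratr i.1.1| < i.2.+1%:R^-1 & `|t - ratr i.1.2| < i.2.+1%:R^-1].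
    by apply: exists_separating_box; rewrite fs ft.
  have := psixy (pickle i); rewrite /psi pickleK; case: pselect => [H|]; last first.
    by case; exists phi.
  have [_ /(_ s t si ti)] := projT2 (cid H).
  by rewrite fs ft.
- exact: compact_set_type compact_path_image.
Qed.

End path.

(** * Pettis integrals along continuous paths *)

(** The retraction of the line onto [[0, 1]]; composing with it turns continuity within [[0, 1]]
    into continuity on the whole line. *)
Definition clamp01 (R : realType) (t : R) : R := Num.max 0 (Num.min t 1).

Section clamp.
Context (R : realType).
Implicit Types s t : R.

Lemma clamp01_ge0 t : 0 <= clamp01 t.
Proof. by rewrite le_max lexx. Qed.

Lemma clamp01_le1 t : clamp01 t <= 1.
Proof. by rewrite ge_max ler01 ge_min lexx orbT. Qed.

Lemma clamp01_id t : 0 <= t -> t <= 1 -> clamp01 t = t.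
Proof. by move=> t0 t1; rewrite /clamp01 (min_idPl t1) (max_idPr t0). Qed.

Lemma clamp01_lipschitz s t : `|clamp01 s - clamp01 t| <= `|s - t|.
Proof.
wlog st : s t / s <= t.
  by move=> H; have [/H//|/ltW/H] := leP s t; rewrite distrC [leRHS]distrC.
rewrite distrC [leRHS]distrC [leRHS]ger0_norm ?subr_ge0// /clamp01 ler_norml.
case: (leP s 1) => ?; case: (leP t 1) => ?;
  [case: (leP 0 s) => ?; case: (leP 0 t) => ?
  |case: (leP 0 s) => ?; case: (leP 0 1) => ?
  |case: (leP 0 1) => ?; case: (leP 0 t) => ?
  |case: (leP 0 1) => ?]; apply/andP; split; lra.
Qed.

Lemma clamp01_continuous : continuous (@clamp01 R).
Proof.
apply: (@lipschitz_continuous_real _ _ 1) => x y.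
by rewrite mul1r clamp01_lipschitz.
Qed.

Lemma within_continuous_clamp01 (T : topologicalType) (f : R -> T) :
  {within `[0, 1], continuous f} -> continuous (f \o @clamp01 R).
Proof.
move=> /subspace_continuousP cf x U fU.
have := cf (clamp01 x); rewrite /= in_itv/= clamp01_ge0 clamp01_le1.
move=> /(_ isT _ fU); rewrite nbhs_filterE /fmap/= => cU.
have : \forall y \near x, `[0, 1]%classic (clamp01 y) -> U (f (clamp01 y)).
  exact: (clamp01_continuous cU).
apply: filterS => y /=; apply.
by rewrite in_itv/= clamp01_ge0 clamp01_le1.
Qed.

End clamp.

(** * Closed convex hulls and averages *)

Section convex_hull.
Context (R : realType) (E : tvsType R).
Implicit Types A K : set E.

Lemma closed_closed_convex_hull K : closed (closed_convex_hull K).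
Proof. by apply: closed_bigI => A [[]]. Qed.

Lemma convex_closed_convex_hull K : convex_set (closed_convex_hull K).
Proof.
apply/convex_setE => x y t t0 t1 Kx Ky A [[cA convA] KA].
by apply: (convex_setE A).1 => //; [exact: Kx|exact: Ky].
Qed.

Lemma sub_closed_convex_hull K : K `<=` closed_convex_hull K.
Proof. exact: sub_gen_smallest. Qed.

(** The average of [n.+2] points is a convex combination, with weight [n.+1%:R / n.+2%:R], of the
    average of the first [n.+1] and the last point. *)
Lemma convex_average A (x : nat -> E) n : convex_set A ->
  (forall k, (k < n.+1)%N -> A (x k)) -> A (n.+1%:R^-1 *: \sum_(k < n.+1) x k).
Proof.
move=> cA; elim: n => [|n IH] Ax.
  by rewrite invr1 scale1r big_ord_recl big_ord0 addr0; exact: Ax.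
have n20 : n.+2%:R != 0 :> R by rewrite pnatr_eq0.
have n10 : n.+1%:R != 0 :> R by rewrite pnatr_eq0.
rewrite big_ord_recr/= scalerDr.
have := (convex_setE A).1 cA _ (x n.+1) (n.+1%:R / n.+2%:R) _ _
  (IH (fun k kn => Ax k (ltnW kn))) (Ax _ (ltnSn _)).
rewrite scalerA mulrAC divff// mul1r.
have -> : 1 - n.+1%:R / n.+2%:R = n.+2%:R^-1 :> R.
  apply: (mulIf n20); rewrite mulrBl mulVf// divfK// mul1r.
  by rewrite -natrB// subSnn.
apply; first by rewrite divr_ge0.
by rewrite ler_pdivrMr ?ltr0n// mul1r ler_nat.
Qed.

End convex_hull.

(** * Existence of Pettis integrals from compact convex sets *)

Section pettis.
Context (R : realType) (E : tvsType R).
Local Notation leb := (@lebesgue_measure R).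

Lemma eq_pettis_integral (f g : R -> E) r :
  (forall x, 0 <= x -> x <= 1 -> f x = g x) ->
  is_pettis_integral leb `[0, 1] f r -> is_pettis_integral leb `[0, 1] g r.
Proof.
move=> fg fr phi cphi; have [iphi ->] := fr phi cphi; split.
  apply: eq_integrable iphi => // x; rewrite inE/= in_itv/= => /andP[x0 x1].
  by rewrite fg.
by apply: eq_integral_itv => x x0 x1; rewrite fg.
Qed.

Lemma continuous_phi_path (f : R -> E) (phi : {linear E -> R^o}) :
  continuous f -> continuous phi -> continuous (fun x => phi (f x) : R).
Proof. by move=> cf cphi x; apply: continuous_comp; [exact: cf|exact: cphi]. Qed.

(** The Riemann sums stay in [C] and have a cluster point [r] there. For each [phi] their images
    converge to the scalar integral and cluster at [phi r], so the two agree. *)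
Lemma pettis_integrable_compact_convex (f : R -> E) (C : set E) :
  continuous f -> compact C -> convex_set C ->
  (forall x, 0 <= x -> x <= 1 -> C (f x)) -> pettis_integrable leb `[0, 1] f.
Proof.
move=> cf cptC convC fC.
pose S (n : nat) : E := n.+1%:R^-1 *: \sum_(k < n.+1) f (k%:R / n.+1%:R).
have SC n : C (S n).
  apply: (convex_average (x := fun k : nat => f (k%:R / n.+1%:R))) => // k kn.
  apply: fC; first by rewrite divr_ge0.
  by rewrite ler_pdivrMr ?ltr0n// mul1r ler_nat ltnW.
have SF : (S @ \oo) C by exists 0%N => // n _; exact: SC.
have [r [_ rS]] := cptC (S @ \oo) _ SF.
exists r => phi cphi; have cpf := continuous_phi_path cf cphi.
split; first exact: continuous_integrable.
have phiS : phi (S n) @[n --> \oo] --> \int[leb]_(x in `[0, 1]) phi (f x).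
  apply: cvg_trans (riemann_sum_cvg cpf); apply: near_eq_cvg.
  by apply: nearW => n; rewrite linearZ/= linear_sum.
set I := (X in _ --> X) in phiS *.
apply/eqP; rewrite -subr_eq0; apply: contrapT => /negP rI.
pose e := `|phi r - I| / 2.
have e0 : 0 < e by rewrite divr_gt0// normr_gt0.
have nearI : (S @ \oo) [set y | `|I - phi y| < e].
  exact: (cvgrPdist_lt _ _).1 phiS e e0.
have nearr : nbhs r [set y | `|phi r - phi y| < e].
  exact: (cvgrPdist_lt _ _).1 (cphi r) e e0.
have [y [/= Iy ry]] := rS _ _ nearI nearr.
have := ler_distD (phi y) (phi r) I; rewrite (distrC (phi y) I).
move: Iy ry; rewrite /e.
set a := `|_|; set b := `|_|; set c := `|_|; lra.
Qed.

Lemma pettis_integrable_path (f : R -> E) : hausdorff_space E ->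
  metric_convex_compactness_property E ->
  {within `[0, 1], continuous f} -> pettis_integrable leb `[0, 1] f.
Proof.
move=> hE mccE /within_continuous_clamp01 cf.
pose K := (f \o @clamp01 R) @` `[0, 1].
have [r fr] : pettis_integrable leb `[0, 1] (f \o @clamp01 R).
  apply: (@pettis_integrable_compact_convex _ (closed_convex_hull K)) => //.
  - by apply: mccE; [exact: compact_path_image|exact: metrizable_path_image].
  - exact: convex_closed_convex_hull.
  - move=> x x0 x1; apply: sub_closed_convex_hull; exists x => //.
    by rewrite /= in_itv/= x0 x1.
exists r; apply: eq_pettis_integral fr => x x0 x1.
by rewrite /= clamp01_id.
Qed.

End pettis.

(** * The closed convex hull of a path *)

Section lipschitz_clocks.
Context (R : realType).

(* Clocks for [[0, 1]] running at speed at most 2, in the topology of pointwise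
   convergence. *)
Definition clocks : set (prod_topology (fun _ : R => R)) :=
  [set h | (forall s, `[0, 1]%classic (h s)) /\
           forall s t, `|h s - h t| <= 2 * `|s - t|].

(** By Tychonoff's theorem the maps into [[0, 1]] form a compact set, and each Lipschitz inequality
    is a closed condition on two coordinates. *)
Lemma compact_clocks : compact clocks.
Proof.
have -> : clocks = [set h | forall s, `[0, 1]%classic (h s)] `&`
    \bigcap_(st in [set: R * R])
      (fun h : prod_topology (fun _ : R => R) => `|h st.1 - h st.2|) @^-1`
        [set x | x <= 2 * `|st.1 - st.2|].
  apply/seteqP; split=> h [h01 hlip]; split=> //.
    by move=> [s t] _; exact: hlip.
  by move=> s t; exact: (hlip (s, t) I).
apply: compact_closedI.
  exact: (@tychonoff R (fun _ => R) (fun _ => `[0, 1]%classic)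
    (fun _ => @segment_compact R 0 1)).
apply: closed_bigI => -[s t] _.
have cdist : continuous (fun h : prod_topology (fun _ : R => R) => `|h s - h t|).
  move=> h.
  have hs : (fun g : prod_topology (fun _ : R => R) => g s) @ h --> h s.
    exact: (@proj_continuous R (fun _ => R) s).
  have ht : (fun g : prod_topology (fun _ : R => R) => g t) @ h --> h t.
    exact: (@proj_continuous R (fun _ => R) t).
  by have := cvg_norm (cvgB hs ht); exact.
exact: (preimage_closed (fun h _ => cdist h) (@closed_le R _)).
Qed.

Lemma clocks_ge0 h s : clocks h -> 0 <= h s.
Proof. by move=> [/(_ s)]; rewrite /= in_itv/= => /andP[]. Qed.

Lemma clocks_le1 h s : clocks h -> h s <= 1.
Proof. by move=> [/(_ s)]; rewrite /= in_itv/= => /andP[]. Qed.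

Lemma clocks_continuous h : clocks h -> continuous (h : R -> R).
Proof. by move=> [_]; exact: lipschitz_continuous_real. Qed.

(** The common Lipschitz constant makes the clocks equicontinuous, so on the compact interval
    pointwise closeness becomes uniform. *)
Lemma clocks_uniform h0 (d : R) : clocks h0 -> 0 < d ->
  \forall h \near within clocks (nbhs h0),
    forall s, 0 <= s -> s <= 1 -> `|h s - h0 s| < d.
Proof.
move=> h0C d0.
have /compact_near_coveringP cpt := @segment_compact R 0 1.
suff cover (s : R) : `[0, 1]%classic s ->
    \forall s' \near s & h \near within clocks (nbhs h0), `|h s' - h0 s'| < d.
  apply: filterS (cpt _ _ (fun h s => `|h s - h0 s| < d) _ cover) => h hd s s0 s1.
  by apply: hd; rewrite /= in_itv/= s0 s1.
move=> _.
(* On this ball each clock moves by less than [d / 4], and the clocks differ by less than [d / 2] at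
   [s]; the total stays below [d]. *)
exists (ball s (d / 8), [set h | clocks h /\ `|h s - h0 s| < d / 2]) => /=.
  split; first by apply: nbhsx_ballx; rewrite divr_gt0.
  have hs : (fun g : prod_topology (fun _ : R => R) => g s) @ h0 --> h0 s.
    exact: (@proj_continuous R (fun _ => R) s).
  have d20 : 0 < d / 2 by rewrite divr_gt0.
  have hsd : nbhs h0 [set h : prod_topology (fun _ : R => R) | `|h0 s - h s| < d / 2].
    exact: (cvgrPdist_lt _ _).1 hs _ d20.
  by apply: filterS hsd => h /= hsd hC; split=> //; rewrite distrC.
move=> [s' h] /= [ss' [hC hs]]; rewrite /ball/= in ss'.
have := hC.2 s' s; have := h0C.2 s s'.
rewrite (distrC s' s).
have := ler_distD (h s) (h s') (h0 s'); have := ler_distD (h0 s) (h s) (h0 s').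
move: hs ss'; lra.
Qed.

(* Every mass of weight [l] at [t] makes the clock stop at [t] during a time
   [l]. *)
Lemma exists_stopping_clock (p : seq (R * R)) :
  (forall q, q \in p -> [/\ 0 <= q.1, 0 <= q.2 & q.2 <= 1]) ->
  exists h : R -> R, [/\ forall s, 0 <= h s <= 1,
    forall s t, `|h s - h t| <= `|s - t|,
    forall t, 0 <= t -> t <= 1 ->
      exists s, [/\ 0 <= s, s <= 1 + \sum_(q <- p) q.1 & h s = t] &
    forall u, continuous u ->
      \int[@lebesgue_measure R]_(s in `[0, (1 + \sum_(q <- p) q.1)]) u (h s) =
      \int[@lebesgue_measure R]_(s in `[0, 1]) u s + \sum_(q <- p) q.1 * u q.2].
Proof.
elim: p => [_|[l t] p IH pP].
  exists (@clamp01 R); split.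
  - by move=> s; rewrite clamp01_ge0 clamp01_le1.
  - exact: clamp01_lipschitz.
  - by move=> t t0 t1; exists t; rewrite big_nil addr0 clamp01_id.
  - move=> u cu; rewrite !big_nil !addr0; apply: eq_integral_itv => s s0 s1.
    by rewrite clamp01_id.
have [l0 t0 t1] := pP (l, t) (mem_head _ _).
have [|h [h01 hlip hsurj hint]] := IH.
  by move=> q qp; apply: pP; rewrite inE qp orbT.
(* The surjectivity clause supplies a time [c] at which the previous clock shows [t]; the new stop
   is inserted there. *)
have [c [c0 cT hc]] := hsurj t t0 t1.
exists (fun s => h (stop c l s)); split=> [s|s s'|t' t'0 t'1|u cu].
- exact: h01.
- exact: le_trans (hlip _ _) (stop_lipschitz _ _ _ _).
- have [s [s0 sT hs]] := hsurj t' t'0 t'1; rewrite big_cons/= addrCA.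
  have [sc|cs] := leP s c.
    exists s; split=> //; first by rewrite (le_trans sT)// lerDr.
    by rewrite /stop (min_idPl _) ?hs// le_max sc.
  exists (l + s); split; [exact: addr_ge0|by rewrite lerD2l|].
  by rewrite /stop addrC addrK (max_idPr (ltW cs)) (min_idPr _) ?hs// lerDl.
- rewrite !big_cons/= [l + _]addrC addrA.
  have cuh : continuous (fun s => u (h s)).
    move=> s; apply: continuous_comp; last exact: cu.
    by apply: (@lipschitz_continuous_real _ _ 1) => x y; rewrite mul1r.
  by rewrite (@integral_stop _ (fun s => u (h s)))// hint// hc; ring.
Qed.

(** Weights of sum 1 give a stopping clock of duration 2. Run at double speed it fits into [[0, 1]],
    whence the Lipschitz constant and the factor 2. *)
Lemma exists_clock (p : seq (R * R)) :
  (forall q, q \in p -> [/\ 0 <= q.1, 0 <= q.2 & q.2 <= 1]) ->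
  \sum_(q <- p) q.1 = 1 ->
  exists2 h, clocks h & forall u : R -> R, continuous u ->
    2 * \int[@lebesgue_measure R]_(s in `[0, 1]) u (h s) =
    \int[@lebesgue_measure R]_(s in `[0, 1]) u s + \sum_(q <- p) q.1 * u q.2.
Proof.
move=> pP p1; have [h [h01 hlip _ hint]] := exists_stopping_clock pP.
exists (fun s => h (2 * s)).
  split=> [s|s t]; first by rewrite /= in_itv/=; exact: h01.
  by rewrite (le_trans (hlip _ _))// -mulrBr normrM ger0_norm.
move=> u cu.
have cuh : continuous (fun s => u (h s)).
  move=> s; apply: continuous_comp; last exact: cu.
  by apply: (@lipschitz_continuous_real _ _ 1) => x y; rewrite mul1r.
have := @integral_affine _ (fun s => u (h s)) 2 0 0 1 (ltr0Sn _ _) ler01 cuh.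
rewrite mulr0 mulr1 !addr0.
under eq_Rintegral do rewrite addr0.
move=> ->; rewrite mulrA divff ?pnatr_eq0// mul1r.
by have := hint u cu; rewrite p1.
Qed.

End lipschitz_clocks.

(** * Integrals along clocks and convex combinations of points of a path *)

Section pettis_hull.
Context (R : realType) (E : tvsType R) (hE : hausdorff_space E).
Local Notation leb := (@lebesgue_measure R).
Hypothesis pettisE : forall f : R -> E, {within `[0, 1], continuous f} ->
  pettis_integrable leb `[0, 1] f.

(** A total choice function; for continuous [g] the hypothesis [pettisE] ensures that the value is
    the Pettis integral. *)
Let pint (g : R -> E) : E := xget 0 [set r | is_pettis_integral leb `[0, 1] g r].

Let pintE (g : R -> E) (phi : {linear E -> R^o}) : continuous g ->
  continuous phi -> phi (pint g) = \int[leb]_(s in `[0, 1]) phi (g s).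
Proof.
move=> cg cphi; have [r gr] := pettisE (@continuous_subspaceT _ _ _ g cg).
have gpint : is_pettis_integral leb `[0, 1] g (pint g).
  exact: (@xgetPex _ 0 [set r | is_pettis_integral leb `[0, 1] g r] (ex_intro _ r gr)).
exact: (gpint phi cphi).2.
Qed.

Context (f : R -> E) (cf : continuous f).

Let continuous_fclock h : clocks h -> continuous (fun s => f (h s)).
Proof.
move=> hC s; apply: continuous_comp; last exact: cf.
exact: clocks_continuous hC s.
Qed.

(** For [h] uniformly close to [h0], all differences [f (h s) - f (h0 s)] lie in one half of [V]. If
    the difference of the integrals were outside [V], a separating functional would be at least 1 on
    it, yet at most 1/2 after integration. *)
Let continuous_pint_clock :
  {within @clocks R, continuous (fun h => pint (fun s => f (h s)))}.
Proof.
apply/subspace_continuousP => h0 h0C W W0.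
pose z := pint (fun s => f (h0 s)).
have W'0 : nbhs 0 [set y : E | W (z + y)].
  suff : z + y @[y --> (0 : E)] --> z by exact.
  by rewrite -[X in _ --> X]addr0; apply: tvs_cvgD; [exact: cvg_cst|exact: cvg_id].
have [V [V0 cV VW]] := nbhs0_convex W'0.
have V20 : nbhs 0 [set y : E | V (2 *: y)].
  suff : 2 *: y @[y --> (0 : E)] --> (0 : E) by exact.
  by rewrite -[X in _ --> X](scaler0 _ 2); apply: tvs_cvgZ; [exact: cvg_cst|exact: cvg_id].
have [d d0 fd] := tvs_uniformly_continuous_itv01 cf V20.
have near_h : nbhs h0 [set h | clocks h ->
    forall s, 0 <= s -> s <= 1 -> `|h s - h0 s| < d] := clocks_uniform h0C d0.
suff : nbhs h0 [set h | clocks h -> W (pint (fun s => f (h s)))] by exact.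
apply: filterS near_h => h /= hd hC.
set w := pint _; rewrite -[w](subrKC z); apply: VW; apply: contrapT => Vw.
have [phi [cphi phiV phiw]] := separation_convex_nbhs V0 cV Vw.
have ch := continuous_fclock hC; have ch0 := continuous_fclock h0C.
have cph := continuous_phi_path ch cphi.
have cph0 := continuous_phi_path ch0 cphi.
suff : phi (w - z) <= 2^-1 by lra.
rewrite linearB/= /w /z !pintE//.
rewrite -RintegralB//; [|exact: continuous_integrable|exact: continuous_integrable].
rewrite -[leRHS]mulr1 -[X in _ <= _ * X](subr0 1) -integral_const//.
apply: le_Rintegral => //.
- have cB : continuous (fun s => phi (f (h s)) - phi (f (h0 s)) : R).
    by move=> s; apply: cvgB; [exact: cph|exact: cph0].
  exact: continuous_integrable.
- by apply: (@continuous_integrable _ (fun=> 2^-1)) => s; exact: cvg_cst.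
move=> s; rewrite /= in_itv/= => /andP[s0 s1].
have := phiV _ (fd (h s) (h0 s) (clocks_ge0 s hC) (clocks_le1 s hC) (hd hC s s0 s1)).
rewrite linearZ linearB/= /GRing.scale/=; lra.
Qed.

Let hull : set E :=
  (fun x => 2 *: x - pint f) @` ((fun h => pint (fun s => f (h s))) @` @clocks R).

Let compact_hull : compact hull.
Proof.
apply: continuous_compact.
  apply: continuous_subspaceT => x; apply: tvs_cvgB; last exact: cvg_cst.
  by apply: tvs_cvgZ; [exact: cvg_cst|exact: cvg_id].
exact: continuous_compact continuous_pint_clock (@compact_clocks R).
Qed.

(** Entries are pairs of a weight and a time. Lists may repeat times, so a mixture of two
    combinations is a concatenation of rescaled lists. *)
Definition path_combination (p : seq (R * R)) : E :=
  \sum_(q <- p) q.1 *: f q.2.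

Definition convex_weights (p : seq (R * R)) : Prop :=
  (forall q, q \in p -> [/\ 0 <= q.1, 0 <= q.2 & q.2 <= 1]) /\
  \sum_(q <- p) q.1 = 1.

(** Every continuous functional takes the same value on both points, by the scalar identity for the
    clock of [p]; such functionals separate points. *)
Let combination_hull p : convex_weights p -> hull (path_combination p).
Proof.
move=> [pP p1]; have [h hC hint] := exists_clock pP p1.
exists (pint (fun s => f (h s))); first by exists h.
apply: (continuous_linear_separates hE) => phi cphi.
rewrite linearB linearZ/= /GRing.scale/= !pintE//; last exact: continuous_fclock.
have -> := hint _ (continuous_phi_path cf cphi).
rewrite addrAC subrr add0r linear_sum.
by apply: eq_bigr => q _; rewrite linearZ.
Qed.

Let combinations : set E := [set path_combination p | p in convex_weights].

Lemma convex_combinations : convex_set combinations.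
Proof.
apply/convex_setE => _ _ t t0 t1 [p [pP p1] <-] [q [qP q1] <-].
exists ([seq (t * r.1, r.2) | r <- p] ++ [seq ((1 - t) * r.1, r.2) | r <- q]).
  split.
    move=> r; rewrite mem_cat => /orP[] /mapP[r' r'pq ->]/=.
      by have [r0 r1 r2] := pP _ r'pq; split=> //; exact: mulr_ge0.
    by have [r0 r1 r2] := qP _ r'pq; split=> //; rewrite mulr_ge0// subr_ge0.
  by rewrite big_cat !big_map/= -!mulr_sumr p1 q1; ring.
rewrite /path_combination big_cat !big_map/= !scaler_sumr.
by congr (_ + _); apply: eq_bigr => r _; rewrite scalerA.
Qed.

Lemma convex_closure (A : set E) : convex_set A -> convex_set (closure A).
Proof.
move=> cA; apply/convex_setE => x y t t0 t1 Ax Ay W Wxy.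
have : t *: z.1 + (1 - t) *: z.2 @[z --> (x, y)] --> t *: x + (1 - t) *: y.
  apply: tvs_cvgD; apply: tvs_cvgZ; try exact: cvg_cst.
    exact: cvg_fst.
  exact: cvg_snd.
move=> /(_ _ Wxy)[[X Y] [/= /Ax[x' [Ax' Xx']] /Ay[y' [Ay' Yy']]] XYW].
exists (t *: x' + (1 - t) *: y'); split; last exact: (XYW (x', y')).
exact: (convex_setE A).1.
Qed.

(** Convexity comes from [combinations], compactness from [hull]: the closed convex hull of [K] lies
    in the closure of [combinations], which lies in [hull] because compact sets of a Hausdorff space
    are closed. *)
Lemma compact_closed_convex_hull_path (K : set E) : K `<=` f @` `[0, 1] ->
  compact (closed_convex_hull K).
Proof.
move=> Kf; apply: (@subclosed_compact E _ hull); [|exact: compact_hull|].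
  exact: closed_closed_convex_hull.
have clh : closed hull by apply: compact_closed => //; exact: compact_hull.
apply: (@subset_trans _ (closure combinations)).
  apply: smallest_sub.
    by split; [exact: closed_closure|exact/convex_closure/convex_combinations].
  move=> x /Kf[t]; rewrite /= in_itv/= => /andP[t0 t1] <-.
  apply: subset_closure; exists [:: (1, t)].
    by split; [move=> q /[!inE] /eqP ->|rewrite big_seq1].
  by rewrite /path_combination big_seq1 scale1r.
rewrite [X in _ `<=` X]((closure_id _).1 clh); apply: closure_subset.
by move=> _ [p pP <-]; exact: combination_hull.
Qed.

End pettis_hull.

(** * A path through a compact metrizable set *)

Section gaps.
Context (R : realType) (E : tvsType R).
Implicit Types (Z : set R) (g f : R -> E) (a b x z : R).

(** The degenerate case [a = b] is allowed, so that every point of [Z] lies in a gap too. *)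
Definition gap Z a b : Prop :=
  [/\ Z a, Z b & forall z, Z z -> z <= a \/ b <= z].

(* If [a = b], then [(x - a) / (b - a) = 0]. *)
Definition interpolation g a b x : E :=
  g a + ((x - a) / (b - a)) *: (g b - g a).

(** A relation that does not fix the choice of gaps; it is preserved by the reflection of the line,
    which reduces continuity to right continuity. *)
Definition interpolates Z g f : Prop := forall x, exists a b,
  [/\ gap Z a b, a <= x, x <= b & f x = interpolation g a b x].

Definition relatively_continuous Z g : Prop := forall z W, Z z ->
  nbhs (g z) W -> exists2 d, 0 < d & forall z', Z z' -> `|z' - z| < d -> W (g z').

Lemma interpolation_left g a b : interpolation g a b a = g a.
Proof. by rewrite /interpolation subrr mul0r scale0r addr0. Qed.

Lemma interpolation_right g a b : interpolation g a b b = g b.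
Proof.
rewrite /interpolation; have [->|ab] := eqVneq a b; first by rewrite !subrr scaler0 addr0.
by rewrite divff ?scale1r ?subrKC// subr_eq0 eq_sym.
Qed.

Lemma interpolation_convex g a b x (V : set E) : convex_set V ->
  a <= x -> x <= b -> V (g a) -> V (g b) -> V (interpolation g a b x).
Proof.
move=> cV ax xb Va Vb; have [ab|ab] := eqVneq a b.
  by rewrite -(_ : a = x) ?interpolation_left//; apply/le_anti; rewrite ax ab xb.
have ba0 : 0 < b - a by rewrite subr_gt0 lt_neqAle ab (le_trans ax).
have := (convex_setE V).1 cV _ _ ((x - a) / (b - a)) _ _ Vb Va.
rewrite /interpolation; set t := _ / _.
have -> : t *: g b + (1 - t) *: g a = g a + t *: (g b - g a).
  by rewrite scalerBl scale1r scalerBr addrCA.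
apply; first by rewrite divr_ge0 ?subr_ge0// (le_trans ax).
by rewrite ler_pdivrMr// mul1r lerD2r.
Qed.

Lemma interpolation_continuous g a b : continuous (interpolation g a b).
Proof.
move=> x; apply: tvs_cvgD; first exact: cvg_cst.
apply: tvs_cvgZ; last exact: cvg_cst.
apply: cvgM; last exact: cvg_cst.
by apply: cvgB; [exact: cvg_id|exact: cvg_cst].
Qed.

Lemma interpolation_opp g a b x :
  a <= x -> x <= b -> interpolation (fun y => g (- y)) (- b) (- a) (- x) =
  interpolation g a b x.
Proof.
move=> ax xb; have [ab|ab] := eqVneq a b.
  have -> : x = a by apply/le_anti; rewrite ax ab xb.
  by rewrite interpolation_right interpolation_left opprK.
have ab0 : b - a != 0 by rewrite subr_eq0 eq_sym.
rewrite /interpolation !opprK.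
have -> : (- x + b) / (- a + b) = 1 - (x - a) / (b - a).
  by rewrite [- a + b]addrC; field.
by rewrite scalerBl scale1r -scalerN opprB addrA subrKC.
Qed.

Lemma interpolates_opp Z g f : interpolates Z g f ->
  interpolates [set x | Z (- x)] (fun x => g (- x)) (fun x => f (- x)).
Proof.
move=> fP x; have [a [b [[Za Zb ab] ax xb fx]]] := fP (- x).
exists (- b), (- a); split; [|by rewrite lerNl|by rewrite lerNr|].
  split; rewrite /= ?opprK// => z /ab[za|bz].
    by right; rewrite lerNl.
  by left; rewrite lerNr.
by rewrite fx -interpolation_opp// opprK.
Qed.

(** A point of [Z] in the closed gap [[a, b]] is one of its endpoints. *)
Lemma interpolates_on Z g f z : interpolates Z g f -> Z z -> f z = g z.
Proof.
move=> fP Zz; have [a [b [[Za Zb /(_ z Zz) abz] az zb ->]]] := fP z.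
case: abz => [za|bz].
  by rewrite (_ : a = z) ?interpolation_left//; apply/le_anti; rewrite az za.
by rewrite (_ : b = z) ?interpolation_right//; apply/le_anti; rewrite zb bz.
Qed.

(** Any gap around a point strictly between [x0] and [b] must be [(a, b)] itself, so [f] is affine
    just to the right of [x0]. *)
Lemma interpolates_right_continuous_gap Z g f x0 a b W : interpolates Z g f ->
  gap Z a b -> a <= x0 -> x0 < b -> f x0 = interpolation g a b x0 ->
  nbhs (f x0) W ->
  exists2 d, 0 < d & forall x, x0 <= x -> x < x0 + d -> W (f x).
Proof.
move=> fP [Za Zb ab] ax0 x0b fx0; rewrite fx0.
move=> /(@interpolation_continuous g a b x0)[d /= d0 dW].
exists (Num.min d (b - x0)); first by rewrite lt_min d0 subr_gt0.
move=> x; rewrite le_eqVlt => /predU1P[<- _|x0x].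
  by rewrite fx0; apply: dW; rewrite /= subrr normr0.
rewrite -ltrBlDl lt_min => /andP[xd xb].
have [a' [b' [[Za' Zb' ab'] ax xb' ->]]] := fP x.
have aa' : a' = a.
  apply/le_anti/andP; split.
    by have [//|] := ab a' Za'; lra.
  by have [//|] := ab' a Za; lra.
have bb' : b' = b.
  apply/le_anti/andP; split; last by have [|//] := ab b' Zb'; lra.
  by have [|//] := ab' b Zb; lra.
by rewrite aa' bb'; apply: dW; rewrite /= distrC gtr0_norm ?subr_gt0.
Qed.

Lemma interpolates_right_continuous Z g f x0 W : interpolates Z g f ->
  relatively_continuous Z g -> nbhs (f x0) W ->
  exists2 d, 0 < d & forall x, x0 <= x -> x < x0 + d -> W (f x).
Proof.
move=> fP gZ Wx0; have [a0 [b0 [ab0 a0x0 x0b0 fx0]]] := fP x0.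
move: x0b0; rewrite le_eqVlt => /predU1P[x0b0|x0b0]; last first.
  exact: interpolates_right_continuous_gap ab0 a0x0 x0b0 fx0 Wx0.
have Zx0 : Z x0 by rewrite x0b0; case: ab0.
have fx0g := interpolates_on fP Zx0.
have W0 : nbhs 0 [set y : E | W (g x0 + y)].
  suff : g x0 + y @[y --> (0 : E)] --> g x0 by rewrite -fx0g => /(_ _ Wx0).
  by rewrite -[X in _ --> X]addr0; apply: tvs_cvgD; [exact: cvg_cst|exact: cvg_id].
have [V [V0 cV VW]] := nbhs0_convex W0.
have V'x0 : nbhs (g x0) [set y | V (y - g x0)].
  suff : y - g x0 @[y --> g x0] --> (0 : E) by exact.
  by rewrite -(subrr (g x0)); apply: tvs_cvgB; [exact: cvg_id|exact: cvg_cst].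
have cV' : convex_set [set y | V (y - g x0)].
  apply/convex_setE => y y' t t0 t1 /= Vy Vy'.
  have := (convex_setE V).1 cV _ _ t t0 t1 Vy Vy'.
  by rewrite !scalerBr addrACA -opprD -scalerDl subrKC scale1r.
have [d d0 dV] := gZ x0 _ Zx0 V'x0.
(* If this gap starts at [x0], then [f] is affine to the right. Otherwise [a] is a point of [Z] in
   []x0, x0 + d / 2]], the gaps of points of []x0, a[] have their endpoints in [[x0, a]], where [g]
   is close to [g x0], and convexity of [V] controls the interpolation. *)
have [a [b [ab ax xb _]]] := fP (x0 + d / 2).
have [ax0|x0a] := leP a x0.
  apply: (interpolates_right_continuous_gap fP _ (lexx x0) _ _ Wx0).
  - have -> : x0 = a; last exact: ab.
    apply/le_anti; rewrite ax0 andbT; case: ab => _ _ /(_ _ Zx0)[//|bx0].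
    by lra.
  - by lra.
  - by rewrite interpolation_left.
exists (a - x0); first by rewrite subr_gt0.
move=> x; rewrite le_eqVlt => /predU1P[<- _|x0x]; first exact: nbhs_singleton.
rewrite subrKC => xa.
have [a' [b' [[Za' Zb' ab'] a'x xb' ->]]] := fP x.
have Za : Z a by case: ab.
have x0a' : x0 <= a' by have [//|] := ab' _ Zx0; lra.
have b'a : b' <= a by have [|//] := ab' _ Za; lra.
suff : V (interpolation g a' b' x - g x0).
  by move=> /VW /=; rewrite subrKC.
apply: (@interpolation_convex g a' b' x _ cV') => //; apply: dV => //.
  by rewrite ger0_norm ?subr_ge0//; lra.
by rewrite ger0_norm ?subr_ge0//; lra.
Qed.

Lemma interpolates_continuous Z g f : interpolates Z g f ->
  relatively_continuous Z g -> continuous f.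
Proof.
move=> fP gZ x0 W Wx0.
have [d1 d10 dr] := interpolates_right_continuous fP gZ Wx0.
have gZ' : relatively_continuous [set x | Z (- x)] (fun x => g (- x)).
  move=> z U Zz Uz; have [d d0 dU] := gZ _ _ Zz Uz.
  exists d => // z' Zz' zz'; apply: dU => //.
  by rewrite opprK addrC distrC.
have Wx0' : nbhs (f (- - x0)) W by rewrite opprK.
have [d2 d20 dl] := interpolates_right_continuous (interpolates_opp fP) gZ' Wx0'.
exists (Num.min d1 d2); first by rewrite /= lt_min d10.
move=> x /=; rewrite lt_min => /andP[xd1 xd2].
have [x0x|/ltW xx0] := leP x0 x.
  by apply: dr => //; move: xd1; rewrite distrC ger0_norm ?subr_ge0//; lra.
rewrite -[x]opprK; apply: dl; first by rewrite lerN2.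
by move: xd2; rewrite ger0_norm ?subr_ge0//; lra.
Qed.

Lemma closed_inf Z : closed Z -> Z !=set0 -> has_lbound Z -> Z (inf Z).
Proof.
move=> cZ [z Zz] lbZ; rewrite /inf; have -> : -%R @` Z = [set x | Z (- x)].
  by apply/seteqP; split=> x; [move=> [y Zy <-]|exists (- x)]; rewrite /= ?opprK.
have cZ' : closed [set x | Z (- x)].
  by apply: preimage_closed cZ => x _; exact: oppr_continuous.
have : closure [set x | Z (- x)] (sup [set x | Z (- x)]).
  apply: closure_sup; first by exists (- z); rewrite /= opprK.
  case: lbZ => m mZ; exists (- m) => x Zx; rewrite lerNr; exact: mZ.
by rewrite -((closure_id _).1 cZ').
Qed.

(** The endpoints are the last point of [Z] up to [x] and the first one from [x] on; they exist
    because [Z] is closed. *)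
Lemma exists_gap Z x : closed Z -> (exists2 z, Z z & z <= x) ->
  (exists2 z, Z z & x <= z) -> exists a b, [/\ gap Z a b, a <= x & x <= b].
Proof.
move=> cZ [z1 Zz1 z1x] [z2 Zz2 xz2].
pose L := Z `&` [set z | z <= x]; pose U := Z `&` [set z | x <= z].
have cL : closed L by apply: closedI => //; exact: closed_le.
have cU : closed U by apply: closedI => //; exact: closed_ge.
have Lub : has_ubound L by exists x => z [].
have Ulb : has_lbound U by exists x => z [].
have Ls : L (sup L).
  by rewrite [X in X _]((closure_id _).1 cL); apply: closure_sup => //; exists z1.
have Us : U (inf U).
  by apply: closed_inf => //; exists z2.
exists (sup L), (inf U); case: (Ls) => ZL Lx; case: (Us) => ZU Ux; split=> //.
split=> // z Zz; have [zx|xz] := leP z x.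
  by left; apply: ub_le_sup.
by right; apply: ge_inf => //; split=> //; exact: ltW.
Qed.

Lemma continuous_extension Z g : closed Z ->
  (forall x, exists2 z, Z z & z <= x) -> (forall x, exists2 z, Z z & x <= z) ->
  relatively_continuous Z g ->
  exists2 f, continuous f & forall z, Z z -> f z = g z.
Proof.
move=> cZ Zle Zge gZ.
have H x : exists ab : R * R, [/\ gap Z ab.1 ab.2, ab.1 <= x & x <= ab.2].
  have [a [b abP]] := exists_gap cZ (Zle x) (Zge x).
  by exists (a, b).
pose f x := interpolation g (sval (cid (H x))).1 (sval (cid (H x))).2 x.
have fP : interpolates Z g f.
  move=> x; have [ab ax xb] := svalP (cid (H x)).
  by exists (sval (cid (H x))).1, (sval (cid (H x))).2.
exists f; first exact: interpolates_continuous fP gZ.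
by move=> z Zz; exact: interpolates_on fP Zz.
Qed.

End gaps.

(** * The Cantor space as a subset of the unit interval *)

Section cantor_embedding.
Context (R : realType).
Implicit Types (b : cantor_space) (n : nat).

(** Partial sums of the expansion in base 3 with digits 0 and 2, as for the middle-thirds set. They
    are nondecreasing, so their supremum is the sum of the series. *)
Definition ternary_sum b n : R := \sum_(i < n) 2 * (b i)%:R / 3 ^+ i.+1.

Definition ternary b : R := sup (range (ternary_sum b)).

Lemma ternary_sumS b n :
  ternary_sum b n.+1 = ternary_sum b n + 2 * (b n)%:R / 3 ^+ n.+1.
Proof. by rewrite /ternary_sum big_ord_recr. Qed.

Lemma ternary_sum_homo b n m : (n <= m)%N -> ternary_sum b n <= ternary_sum b m.
Proof.
elim: m => [|m IH]; first by rewrite leqn0 => /eqP ->.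
rewrite leq_eqVlt => /predU1P[->//|]; rewrite ltnS => /IH nm.
by rewrite ternary_sumS (le_trans nm)// lerDl divr_ge0// mulr_ge0.
Qed.

(** The right-hand side is the case where all digits from [n] to [m - 1] equal 2. *)
Lemma ternary_sum_le b n m : (n <= m)%N ->
  ternary_sum b m <= ternary_sum b n + (3 ^+ n)^-1 - (3 ^+ m)^-1.
Proof.
elim: m => [|m IH]; first by rewrite leqn0 => /eqP ->; rewrite addrK.
rewrite leq_eqVlt => /predU1P[->|]; first by rewrite addrK.
rewrite ltnS => /IH nm; rewrite ternary_sumS.
have bm : (b m)%:R <= 1 :> R by case: (b m).
have E : (3 ^+ m)^-1 = 3 * (3 ^+ m.+1)^-1 :> R.
  by rewrite exprS invfM mulrA divff ?mul1r// pnatr_eq0.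
have m0 : 0 <= (3 ^+ m.+1)^-1 :> R by rewrite invr_ge0 exprn_ge0.
rewrite E in nm; have : (b m)%:R * (3 ^+ m.+1)^-1 <= (3 ^+ m.+1)^-1 :> R.
  by rewrite ler_piMl.
move: nm; rewrite -mulrA; lra.
Qed.

Lemma ternary_ub b : has_ubound (range (ternary_sum b)).
Proof.
exists 1 => _ [n _ <-]; have := @ternary_sum_le b 0 n (leq0n n).
rewrite /ternary_sum big_ord0 expr0 invr1 add0r => /le_trans; apply.
by rewrite gerBl invr_ge0 exprn_ge0.
Qed.

Lemma ternary_ge b n : ternary_sum b n <= ternary b.
Proof. by apply: ub_le_sup; [exact: ternary_ub|exists n]. Qed.

Lemma ternary_le b n : ternary b <= ternary_sum b n + (3 ^+ n)^-1.
Proof.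
apply: ge_sup; first by exists (ternary_sum b 0), 0%N.
move=> _ [m _ <-]; have [mn|/ltnW nm] := leqP m n.
  by rewrite (le_trans (ternary_sum_homo b mn))// lerDl invr_ge0 exprn_ge0.
rewrite (le_trans (ternary_sum_le b nm))// gerBl invr_ge0 exprn_ge0//.
Qed.

Lemma ternary_ge0 b : 0 <= ternary b.
Proof. by have := ternary_ge b 0; rewrite /ternary_sum big_ord0. Qed.

Lemma ternary_le1 b : ternary b <= 1.
Proof.
by have := ternary_le b 0; rewrite /ternary_sum big_ord0 expr0 invr1 add0r.
Qed.

Lemma eq_ternary_sum b b' n : (forall i, (i < n)%N -> b i = b' i) ->
  ternary_sum b n = ternary_sum b' n.
Proof. by move=> bb'; apply: eq_bigr => i _; rewrite bb'. Qed.

(** At the first differing digit [n] one sum gains [2 / 3 ^+ n.+1], while the tail of the other is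
    at most half of that. *)
Lemma ternary_inj : injective ternary.
Proof.
suff lt b b' n : (forall i, (i < n)%N -> b i = b' i) -> b n = false ->
    b' n = true -> ternary b < ternary b'.
  move=> b b' ebb'; apply/funext => i; apply/eqP; apply: contrapT => /negP bi.
  have ex : exists i, b i != b' i by exists i.
  case: (ex_minnP ex) => n bn nmin.
  have agree j : (j < n)%N -> b j = b' j.
    by move=> jn; apply/eqP; apply: contraTT jn => /nmin; rewrite -leqNgt.
  case Eb : (b n) bn; case Eb' : (b' n) => // _.
    have := lt b' b n (fun j jn => esym (agree j jn)) Eb' Eb.
    by rewrite ebb' ltxx.
  by have := lt b b' n agree Eb Eb'; rewrite ebb' ltxx.
move=> agree bn b'n; apply: le_lt_trans (ternary_le b n.+1) _.
apply: lt_le_trans (ternary_ge b' n.+1).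
rewrite !ternary_sumS bn b'n (eq_ternary_sum agree) mulr0 mul0r addr0 mulr1.
by rewrite ltrD2l -[ltLHS]mul1r ltr_pM2r ?ltr1n// invr_gt0 exprn_gt0.
Qed.

(** Sequences with the same first [n] digits have values in a common interval of length
    [(3 ^+ n)^-1]. *)
Lemma ternary_continuous : continuous ternary.
Proof.
move=> b; apply/cvgrPdist_lt => e e0.
have [n _ /(_ n (leqnn _)) /= ne] := near_infty_natSinv_lt (PosNum e0).
have digits m : \forall b' \near b, forall i, (i < m)%N -> b i = b' i.
  elim: m => [|m IH]; first by apply: filterE => b2 i; rewrite ltn0.
  have bm : \forall b' \near b, b' m = b m.
    have pm := @proj_continuous nat (fun _ => bool) m b.
    have : nbhs (b m) [set x | x = b m] by exact: (@discrete_set1 bool).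
    by move=> /pm.
  near=> b' => i; rewrite ltnS leq_eqVlt => /predU1P[->|].
    by apply/esym; near: b'; exact: bm.
  by move: i; near: b'; exact: IH.
have lt_n : (3 ^+ n)^-1 < e.
  apply: le_lt_trans ne; rewrite lef_pV2 ?posrE ?exprn_gt0//.
  by rewrite -natrX ler_nat ltn_expl.
apply: filterS (digits n) => b' bb'; apply: le_lt_trans lt_n.
have E := eq_ternary_sum bb'.
have := ternary_ge b n; have := ternary_le b n.
have := ternary_ge b' n; have := ternary_le b' n.
rewrite -E ler_norml => *; apply/andP; split; lra.
Unshelve. all: by end_near. Qed.

End cantor_embedding.

(** * Compact metrizable spaces as continuous images of the Cantor space *)

Definition metrizes (R : realType) (T : topologicalType) (d : T -> T -> R) : Prop :=
  [/\ forall x y, d x y = 0 <-> x = y,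
      forall x y, d x y = d y x,
      forall x y z, d x z <= d x y + d y z &
      forall x, nbhs x = nbhs_ball_ (fun y e => [set z | d y z < e]) x].

(** A copy of [T] whose type records a metric and a base point, so that a pointed pseudometric
    structure can be attached to it. Its neighbourhoods are those of [T], so continuity transfers
    unchanged. *)
Definition metrized (R : realType) (T : topologicalType) (d : T -> T -> R)
  (dT : metrizes d) (p : T) : Type := T.

Section metrized.
Context (R : realType) (T : topologicalType) (d : T -> T -> R).
Context (dT : metrizes d) (p : T).
Local Notation M := (metrized dT p).

Let ball (x : M) (e : R) (y : M) : Prop := d x y < e.

Let ball_center x (e : R) : 0 < e -> ball x e x.
Proof. by have [d0 _ _ _] := dT => e0; rewrite /ball (d0 x x).2. Qed.

Let ball_sym x y (e : R) : ball x e y -> ball y e x.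
Proof. by have [_ dC _ _] := dT; rewrite /ball dC. Qed.

Let ball_triangle x y z (e1 e2 : R) :
  ball x e1 y -> ball y e2 z -> ball x (e1 + e2) z.
Proof.
have [_ _ dD _] := dT; rewrite /ball => xy yz.
by rewrite (le_lt_trans (dD x y z))// ltrD.
Qed.

HB.instance Definition _ := Choice.on M.
HB.instance Definition _ := Nbhs.copy M T.
HB.instance Definition _ := isPointed.Build M p.

Let nbhs_ballE : @nbhs M M = nbhs_ (entourage_ ball).
Proof.
have [_ _ _ dN] := dT; apply/funext => x.
rewrite [LHS](dN x); apply/seteqP; split=> A [].
  move=> e e0 eA; exists [set xy | ball xy.1 e xy.2]; first by exists e.
  by move=> y /xsectionP; exact: eA.
move=> U [e e0 eU] UA; exists e => // y xy; apply/UA/xsectionP/eU.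
exact: xy.
Qed.

HB.instance Definition _ := @Nbhs_isPseudoMetric.Build R M
  (entourage_ ball) nbhs_ballE ball ball_center ball_sym ball_triangle erefl.

End metrized.

(** The Alexandroff-Hausdorff theorem applied to the metrized copy, which is Hausdorff because balls
    of half the distance between two points are disjoint. *)
Lemma exists_cantor_surjection (R : realType) (T : topologicalType) (p : T) :
  metrizable R T -> compact [set: T] ->
  exists2 c : cantor_space -> T, continuous c & forall x, exists b, c b = x.
Proof.
move=> [d dT] cptT.
have hT : hausdorff_space (metrized dT p).
  have [d0 dC dD dN] := dT => x y xy; apply/d0/eqP; rewrite eq_le.
  have dxy0 z w : 0 <= d z w.
    by have := dD z w z; rewrite (d0 z z).2// (dC w z); lra.
  rewrite dxy0 andbT leNgt; apply/negP => dxy.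
  have dxy2 : 0 < d x y / 2 by rewrite divr_gt0.
  have Bx z : nbhs (z : metrized dT p) [set w | d z w < d x y / 2].
    by change (nbhs (z : T) [set w | d z w < d x y / 2]); rewrite dN; exists (d x y / 2).
  have [z [/= xz yz]] := xy _ _ (Bx x) (Bx y).
  by have := dD x z y; rewrite (dC z y); lra.
have [c cc] := @cantor_surj R (metrized dT p) cptT hT.
exists c; first exact: cc.
by move=> x; have [b _ <-] := 'surj_c (I : [set: metrized dT p] x); exists b.
Qed.

Lemma exists_path_through (R : realType) (E : tvsType R) (K : set E) :
  compact K -> metrizable R (set_type K) -> K !=set0 ->
  exists2 f : R -> E, continuous f & K `<=` f @` `[0, 1].
Proof.
move=> cptK mK [v Kv]; pose p : set_type K := exist _ v (mem_set Kv).
have [c cc csurj] := exists_cantor_surjection p mK (compact_set_type cptK).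
(* The two half-lines put every real between points of [Z]; on them [g] will be constantly [v]. *)
pose Z : set R := range (@ternary R) `|` ([set x | x <= -1] `|` [set x | 2 <= x]).
pose b0 : cantor_space := fun=> false.
pose digits (z : R) : cantor_space := xget b0 [set b | ternary R b = z].
have digitsK b : digits (ternary R b) = b.
  apply: (@ternary_inj R).
  exact: (@xgetPex _ b0 [set b' | ternary R b' = ternary R b] (ex_intro _ b erefl)).
pose g (z : R) : E := if (0 <= z) && (z <= 1) then set_val (c (digits z)) else v.
have gE b : g (ternary R b) = set_val (c b).
  by rewrite /g ternary_ge0 ternary_le1 digitsK.
have gout z : z < 0 \/ 1 < z -> g z = v.
  by rewrite /g; case=> [z0|z1]; rewrite ?(lt_geF z0)// (lt_geF z1) andbF.
have cZ : closed Z.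
  apply: closedU; last by apply: closedU; [exact: closed_le|exact: closed_ge].
  apply: compact_closed; first exact: Rhausdorff.
  apply: continuous_compact; last exact: cantor_space_compact.
  exact/continuous_subspaceT/ternary_continuous.
have gZ : relatively_continuous Z g.
  move=> z W [[b _ <-]|[|]]; last 2 first.
  - rewrite /= => z1 /nbhs_singleton; rewrite gout; last by left; lra.
    move=> Wv; exists 1 => // z' _; rewrite ltr_norml => /andP[_ zz'].
    by rewrite gout//; left; lra.
  - rewrite /= => z2 /nbhs_singleton; rewrite gout; last by right; lra.
    move=> Wv; exists 1 => // z' _; rewrite ltr_norml => /andP[zz' _].
    by rewrite gout//; right; lra.
  rewrite gE => Wb.
  (* The inverse of [ternary] is continuous on its range by compactness: near [b] continuity of [c]
     applies, and any other [b'] has a neighbourhood whose image stays away from [ternary R b]. *)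
  have /compact_near_coveringP cpt := cantor_space_compact.
  have cover b' : [set: cantor_space] b' -> \forall x \near b' & e \near 0^'+,
      `|ternary R x - ternary R b| < e -> W (set_val (c x)).
    move=> _; have [->|bb'] := eqVneq b' b.
      have ccb : \forall x \near b, W (set_val (c x)).
        have : set_val (c x) @[x --> b] --> set_val (c b).
          by apply: (@continuous_comp _ _ _ c set_val); [exact: cc|exact: initial_continuous].
        by move=> /(_ _ Wb).
      exists ([set x | W (set_val (c x))], setT) => /=.
        by split => //; exact: filterT.
      by move=> [x e] [].
    pose r := `|ternary R b' - ternary R b| / 2.
    have r0 : 0 < r.
      rewrite divr_gt0// normr_gt0 subr_eq0.
      by apply: contra bb' => /eqP/(@ternary_inj R)/eqP.
    exists ([set x | `|ternary R b' - ternary R x| < r], [set e | e < r]) => /=.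
      split; last exact: nbhs_right_lt.
      exact: (cvgrPdist_lt _ _).1 (@ternary_continuous R b') r r0.
    move=> [x e] /= [b'x er] xb; exfalso.
    have := ler_distD (ternary R x) (ternary R b') (ternary R b).
    by move: b'x er xb; rewrite /r; set a := `|_|; set a' := `|_|; set a'' := `|_|; lra.
  have [e /= e0 eW] := cpt R 0^'+ _ _ cover.
  (* The bound 1 excludes the half-lines, which are at distance at least 1 from [[0, 1]]. *)
  exists (Num.min 1 (e / 2)); first by rewrite lt_min ltr01 divr_gt0.
  move=> z' /[swap]; rewrite lt_min => /andP[z1 ze] Zz'.
  case: Zz' z1 ze => [[b' _ <-] _ b'b|[|]/= zout]; last 2 first.
  - by rewrite ltr_norml; have := ternary_ge0 R b; lra.
  - by rewrite ltr_norml; have := ternary_le1 R b; lra.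
  rewrite gE; apply: (eW (e / 2) _ _ b') b'b => //=.
  - by rewrite sub0r normrN gtr0_norm ?divr_gt0// ltr_pdivrMr// ltr_pMr// ltr1n.
  - by rewrite divr_gt0.
have Zle x : exists2 z, Z z & z <= x.
  by exists (Num.min x (-1)); [right; left; rewrite /= ge_min lexx orbT|rewrite ge_min lexx].
have Zge x : exists2 z, Z z & x <= z.
  by exists (Num.max x 2); [right; right; rewrite /= le_max lexx orbT|rewrite le_max lexx].
have [f cf fg] := continuous_extension cZ Zle Zge gZ.
exists f => // y Ky; have [b cb] := csurj (exist _ y (mem_set Ky)).
exists (ternary R b); first by rewrite /= in_itv/= ternary_ge0 ternary_le1.
by rewrite fg ?gE ?cb//; left; exists b.
Qed.

Theorem theorem1 (R : realType) (E : tvsType R) (hE : hausdorff_space E) :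
  metric_convex_compactness_property E <->
  (forall f : R -> E, {within `[0, 1], continuous f} ->
    pettis_integrable (@lebesgue_measure R) `[0, 1] f).
Proof.
split=> [mccE f cf|pettisE K cptK mK]; first exact: pettis_integrable_path.
(* The empty set is treated apart, since the path through [K] requires a base point. *)
have [K0|/set0P K0] := eqVneq K set0.
  have -> : closed_convex_hull K = set0.
    apply/seteqP; split=> //; rewrite K0; apply: smallest_sub => //.
    by split; [exact: closed0|apply/convex_setE].
  exact: compact0.
have [f cf Kf] := exists_path_through cptK mK K0.
exact: (compact_closed_convex_hull_path hE pettisE cf Kf).
Qed.
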